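(* The full subcategory of $\mathbf{OBD}_{\mathrm{po}}$ consisting of simple properly ordered Bratteli diagrams $B$ with infinite $X_B$ is (contravariantly) equivalent to the full subcategory of $\mathbf{SDS}$ consisting of scaled minimal dynamical systems on Cantor sets (i.e. those $(X,\varphi,x_0,\mathcal{R})$ in $\mathbf{SDS}$ with $X$ homeomorphic to the Cantor set and $\varphi$ minimal).
   Context: **Bratteli diagrams.** A Bratteli diagram $(V,E)$ consists of a vertex set $V=V_0\sqcup V_1\sqcup\cdots$ with each $V_n$ finite and non-empty and $V_0$ a singleton, and an edge set $E=E_1\sqcup E_2\sqcup\cdots$ with each $E_n$ finite and non-empty, together with maps $r,s:E\to V$ (range, source) such that $r(E_n)\subseteq V_n$, $s(E_n)\subseteq V_{n-1}$, $s^{-1}\{v\}\neq\varnothing$ for all $v\in V$ and $r^{-1}\{v\}\ne\varnothing$ for all $v\in V\setminus V_0$. It is simple if for each $n\ge0$ there is $m>n$ such that every $v\in V_n$ is connected to every $w\in V_m$ by a path. An ordered Bratteli diagram $(V,E,\geq)$ is a Bratteli diagram with a partial order on $E$ such that $e,e'$ are comparable iff $r(e)=r(e')$. It is properly ordered if there is exactly one infinite path $(e_1,e_2,\ldots)$ ($e_i\in E_i$, $r(e_i)=s(e_{i+1})$) consisting of maximal edges, and exactly one consisting of minimal edges. $X_B$ is the set of all infinite paths $(e_1,e_2,\ldots)$. **Edge sets.** An ordered edge set from a finite set $S$ to a finite set $T$ is a finite set $F$ with maps $s:F\to S$, $r:F\to T$ and a linear order on each $r^{-1}\{w\}$, $w\in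 T$. If $G$ is an ordered edge set from $T$ to $U$, then $F\circ G=\{(e,g)\in F\times G: r(e)=s(g)\}$, with source $s(e)$, range $r(g)$, and order: for $r(g)=r(g')$, $(e,g)<(e',g')$ iff $g<g'$, or $g=g'$ and $e<e'$. Write $F\cong F'$ if there is a bijection $F\to F'$ preserving sources, ranges and order. For $k<l$, $E_{k,l}=E_{k+1}\circ\cdots\circ E_l$; $E_{k,k}$ consists of one edge from $v$ to $v$ for each $v\in V_k$. **The category $\mathbf{OBD}$.** Objects: ordered Bratteli diagrams. An ordered premorphism $f:B=(V,E,\ge)\to C=(W,S,\ge)$ is a triple $(F,(f_n)_{n\ge0},\geq)$ where $(f_n)$ is an unbounded sequence of integers with $0=f_0\le f_1\le\cdots$, and $F=F_0\sqcup F_1\sqcup\cdots$ where each $F_n$ is a non-empty finite ordered edge set from $V_n$ to $W_{f_n}$ such that every $v\in V_n$ is the source and every $w\in W_{f_n}$ the range of some edge of $F_n$, $F_0$ is a singleton, and $E_{n+1}\circ F_{n+1}\cong F_n\circ S_{f_n,f_{n+1}}$ for all $n\ge0$. The composition of $f:B\to C$ and $g=(G,(g_n),\ge):C\to D$ is $gf=(H,(h_n),\ge)$ with $h_n=g_{f_n}$, $H_n=F_n\circ G_{f_n}$. Premorphisms $f,g:B\to C$ are equivalent if there are positive integers $n_1<m_1<n_2<m_2<\cdots$ with $f_{n_k}<g_{m_k}<f_{n_{k+1}}$ and, for all $k\ge1$, $E_{n_k,m_k}\circ G_{m_k}\cong F_{n_k}\circ S_{f_{n_k},g_{m_k}}$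 and $E_{m_k,n_{k+1}}\circ F_{n_{k+1}}\cong G_{m_k}\circ S_{g_{m_k},f_{n_{k+1}}}$. Morphisms in $\mathbf{OBD}$ are equivalence classes $[f]$, with $[g][f]=[gf]$. $\mathbf{OBD}_{\mathrm{po}}$ is the full subcategory of properly ordered Bratteli diagrams. **The category $\mathbf{SDS}$.** An essentially minimal totally disconnected dynamical system $(X,\varphi,x_0)$ consists of a metrizable compact totally disconnected space $X$, a homeomorphism $\varphi$ of $X$ such that $(X,\varphi)$ has a unique minimal (non-empty closed invariant) subset, and a point $x_0$ of that subset. A Kakutani–Rokhlin partition for it is a finite partition $P=\{Z(k,j): 1\le k\le K,\ 1\le j\le J(k)\}$ of $X$ into non-empty clopen sets with $\varphi(Z(k,j))=Z(k,j+1)$ for $1\le j<J(k)$, and such that the top $Z=\bigcup_kZ(k,J(k))$ contains $x_0$ and $\varphi(Z)=\bigcup_kZ(k,1)$. A system of Kakutani–Rokhlin partitions is a sequence $\mathcal{R}=(P_n)_{n\ge0}$ of such partitions with $P_0=\{X\}$, $P_{n+1}$ refining $P_n$, the tops $Z_n$ of $P_n$ ($n\ge1$) decreasing with intersection $\{x_0\}$, and $\bigcup_nP_n$ a basis for the topology of $X$. Objects of $\mathbf{SDS}$ are quadruples $(X,\varphi,x_0,\mathcal{R})$; morphisms $(X,\varphi,x_0,\mathcal{R})\to(Y,\psi,y_0,\mathcal{S})$ are continuous maps $\alpha:X\to Y$ with $\alpha\circ\varphi=\psi\circ\alpha$ and $\alpha(x_0)=y_0$ (no condition relating $\mathcal{R}$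 and $\mathcal{S}$). Two categories are contravariantly equivalent if there is a full, faithful and essentially surjective contravariant functor from one to the other. *)

(* Defs.v *)
From Stdlib Require Setoid.
From HB Require Import structures.
From mathcomp Require Import all_boot.
From mathcomp Require Import boolp classical_sets functions cardinality.
From mathcomp Require Import reals topology cantor.

Set Implicit Arguments.
Unset Strict Implicit.
Unset Printing Implicit Defensive.

Local Open Scope classical_set_scope.

(** * Categories and contravariant equivalences *)

Record category := Category {
  obj :> Type;
  hom : obj -> obj -> Type;
  idm : forall x, hom x x;
  compm : forall x y z, hom y z -> hom x y -> hom x z;
  compmA : forall x y z t (h : hom z t) (g : hom y z) (f : hom x y),
    compm h (compm g f) = compm (compm h g) f;
  compm1 : forall x y (f : hom x y), compm f (idm x) = f;
  comp1m : forall x y (f : hom x y), compm (idm y) f = f }.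

Arguments hom {_} _ _.
Arguments idm {_} _.
Arguments compm {_ _ _ _} _ _.

Definition isomorphic (C : category) (x y : C) : Prop :=
  exists (f : hom x y) (g : hom y x),
    compm g f = idm x /\ compm f g = idm y.

Definition full_subcategory (C : category) (P : C -> Prop) : category :=
  @Category {x : C | P x} (fun x y => hom (sval x) (sval y))
    (fun x => idm (sval x)) (fun x y z g f => compm g f)
    (fun x y z t h g f => compmA h g f)
    (fun x y f => compm1 f) (fun x y f => comp1m f).

Record contravariant_functor (C D : category) := ContravariantFunctor {
  fobj :> C -> D;
  fmap : forall x y : C, hom x y -> hom (fobj y) (fobj x);
  fmap_id : forall x : C, fmap (idm x) = idm (fobj x);
  fmap_comp : forall (x y z : C) (g : hom y z) (f : hom x y),
    fmap (compm g f) = compm (fmap f) (fmap g) }.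

Section FunctorProperties.
Variables (C D : category) (F : contravariant_functor C D).

Definition full : Prop :=
  forall (x y : C) (h : hom (F y) (F x)), exists f : hom x y, fmap F f = h.

Definition faithful : Prop :=
  forall (x y : C) (f g : hom x y), fmap F f = fmap F g -> f = g.

Definition essentially_surjective : Prop :=
  forall d : D, exists c : C, isomorphic (F c) d.

End FunctorProperties.

(** The functor may go in either direction; classically the two disjuncts
    are equivalent. *)
Definition contravariantly_equivalent (C D : category) : Prop :=
  (exists F : contravariant_functor C D,
     [/\ full F, faithful F & essentially_surjective F]) \/
  (exists F : contravariant_functor D C,
     [/\ full F, faithful F & essentially_surjective F]).

(** * Ordered edge sets *)

(** The axiom [edge_le_comparable] says that the partial order [edge_le]
    restricts to a linear order on each fibre of [rng] and relates no edges
    with different ranges. *)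
Record edge_set (S T : finType) := EdgeSet {
  edge :> finType;
  src : edge -> S;
  rng : edge -> T;
  edge_le : rel edge;
  edge_le_refl : reflexive edge_le;
  edge_le_anti : antisymmetric edge_le;
  edge_le_trans : transitive edge_le;
  edge_le_comparable : forall e e',
    edge_le e e' || edge_le e' e = (rng e == rng e') }.

Definition edge_iso (S T : finType) (F G : edge_set S T) : Prop :=
  exists h : F -> G,
    [/\ bijective h, forall e, src (h e) = src e, forall e, rng (h e) = rng e
      & forall e e', edge_le (h e) (h e') = edge_le e e'].

Notation "F ≅ G" := (edge_iso F G) (at level 70, no associativity).

Section EdgeComposition.
Variables (S T U : finType) (F : edge_set S T) (G : edge_set T U).

Definition ecomp_edge : finType := {p : F * G | rng p.1 == src p.2}.

Definition ecomp_le : rel ecomp_edge := fun p q =>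
  ((sval p).2 != (sval q).2) && edge_le (sval p).2 (sval q).2
  || ((sval p).2 == (sval q).2) && edge_le (sval p).1 (sval q).1.

Lemma ecomp_le_refl : reflexive ecomp_le.
Proof. by move=> p; rewrite /ecomp_le eqxx !edge_le_refl. Qed.

Lemma ecomp_le_anti : antisymmetric ecomp_le.
Proof.
move=> [[e g] p] [[e' g'] p'] /andP[]; rewrite /ecomp_le /= (eq_sym g' g).
case: eqVneq => [gg' | ng] /=; last first.
  by rewrite !orbF => h1 h2; case/eqP: ng; apply: edge_le_anti; rewrite h1 h2.
move=> h1 h2; apply: val_inj => /=; rewrite gg'; congr (_, _).
by apply: edge_le_anti; rewrite h1 h2.
Qed.

Lemma ecomp_le_trans : transitive ecomp_le.
Proof.
move=> [[e' g'] p'] [[e g] p] [[e'' g''] p'']; rewrite /ecomp_le /=.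
case: (eqVneq g g') => [-> | n1] /=.
  by case: (eqVneq g' g'') => [-> | n2] //=; apply: edge_le_trans.
rewrite orbF => h1; case: (eqVneq g' g'') => [<- _ | n2] /=.
  by rewrite n1 h1.
rewrite orbF => h2; case: (eqVneq g g'') => [eg | n3] /=.
  by case/eqP: n1; apply: edge_le_anti; rewrite h1 eg h2.
by rewrite (edge_le_trans h1 h2).
Qed.

Lemma ecomp_le_comparable (p q : ecomp_edge) :
  ecomp_le p q || ecomp_le q p = (rng (sval p).2 == rng (sval q).2).
Proof.
case: p q => [[e g] p] [[e' g'] q]; rewrite /ecomp_le /= (eq_sym g' g).
move: p q => /= /eqP p /eqP q.
case: eqVneq => [gg' | ng] /=; last by rewrite !orbF edge_le_comparable.
by rewrite edge_le_comparable p q gg' !eqxx.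
Qed.

Definition ecomp : edge_set S U :=
  @EdgeSet S U ecomp_edge
    (fun p => src (sval p).1) (fun p => rng (sval p).2) ecomp_le
    ecomp_le_refl ecomp_le_anti ecomp_le_trans ecomp_le_comparable.

End EdgeComposition.

Notation "F ∘ G" := (ecomp F G) (at level 40, left associativity).

(** [ediag V k l] has one edge for each vertex lying in both [V k] and [V l],
    the family [V] being read as a disjoint union: for [k = l] it has exactly
    one edge from [v] to [v] for each [v], for [k <> l] it is empty.  Leaving
    both levels free avoids transporting along equalities of levels. *)
Section DiagonalEdges.
Variables (V : nat -> finType) (k l : nat).

Definition ediag_edge : finType :=
  {p : V k * V l | existT (fun n => V n : Type) k p.1
                   == existT (fun n => V n : Type) l p.2}.

Lemma ediag_anti : antisymmetric (@eq_op ediag_edge).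
Proof. by move=> p q /andP[/eqP]. Qed.

Lemma ediag_trans : transitive (@eq_op ediag_edge).
Proof. exact: eq_op_trans. Qed.

Lemma ediag_comparable (p q : ediag_edge) :
  (p == q) || (q == p) = ((sval p).2 == (sval q).2).
Proof.
rewrite (eq_sym q p) orbb; apply/eqP/eqP => [-> // |].
case: p q => [[v w] p] [[v' w'] q] /= ww'; apply: val_inj => /=.
move: p q => /= /eqP p /eqP q; rewrite -ww' in q *; congr (_, _).
by apply: (@eq_from_Tagged _ (fun n => V n : Type) k); rewrite /Tagged p q.
Qed.

Definition ediag : edge_set (V k) (V l) :=
  @EdgeSet (V k) (V l) ediag_edge
    (fun p => (sval p).1) (fun p => (sval p).2) eq_op
    (@eqxx _) ediag_anti ediag_trans ediag_comparable.

End DiagonalEdges.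

(** * Ordered Bratteli diagrams *)

(** [edges n] is the edge set from level [n] to level [n + 1], usually
    written E_{n+1}. *)
Record ordered_bratteli := OrderedBratteli {
  vert : nat -> finType;
  edges : forall n, edge_set (vert n) (vert n.+1);
  vert_neq0 : forall n, (0 < #|vert n|)%N;
  vert0 : #|vert 0| = 1%N;
  edges_neq0 : forall n, (0 < #|edges n|)%N;
  edges_src : forall n (v : vert n), exists e : edges n, src e = v;
  edges_rng : forall n (w : vert n.+1), exists e : edges n, rng e = w }.

Arguments edges : clear implicits.

(** E_{k,l}, for [k <= l]. *)
Fixpoint espan (B : ordered_bratteli) (k l : nat) :
    edge_set (vert B k) (vert B l) :=
  match l with
  | 0 => ediag (vert B) k 0
  | l'.+1 => if (k <= l')%N then espan B k l' ∘ edges B l'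
             else ediag (vert B) k l'.+1
  end.

Definition infinite_paths (B : ordered_bratteli) :
    set (forall n, edges B n) :=
  [set x | forall n, rng (x n) = src (x n.+1)].

Arguments infinite_paths : clear implicits.

Definition maximal_edge (S T : finType) (F : edge_set S T) (e : F) : Prop :=
  forall e' : F, edge_le e e' -> e' = e.

Definition minimal_edge (S T : finType) (F : edge_set S T) (e : F) : Prop :=
  forall e' : F, edge_le e' e -> e' = e.

Definition properly_ordered (B : ordered_bratteli) : Prop :=
  (exists! x, infinite_paths B x /\ forall n, maximal_edge (x n)) /\
  (exists! x, infinite_paths B x /\ forall n, minimal_edge (x n)).

Definition simple_bratteli (B : ordered_bratteli) : Prop :=
  forall n, exists2 m, (n < m)%N &
    forall (v : vert B n) (w : vert B m),
      exists e : espan B n m, src e = v /\ rng e = w.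

(** * Ordered premorphisms *)

Record premorphism (B C : ordered_bratteli) := Premorphism {
  plevel : nat -> nat;
  pedge : forall n, edge_set (vert B n) (vert C (plevel n));
  plevel0 : plevel 0 = 0%N;
  plevel_le : forall n, (plevel n <= plevel n.+1)%N;
  plevel_unbounded : forall M, exists n, (M < plevel n)%N;
  pedge_neq0 : forall n, (0 < #|pedge n|)%N;
  pedge_src : forall n (v : vert B n), exists e : pedge n, src e = v;
  pedge_rng : forall n (w : vert C (plevel n)),
    exists e : pedge n, rng e = w;
  pedge0 : #|pedge 0| = 1%N;
  pedge_commute : forall n,
    edges B n ∘ pedge n.+1
    ≅ pedge n ∘ espan C (plevel n) (plevel n.+1) }.

Definition pequiv (B C : ordered_bratteli) (f g : premorphism B C) : Prop :=
  exists n m : nat -> nat, forall k,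
    [/\ (0 < n k < m k)%N /\ (m k < n k.+1)%N,
        (plevel f (n k) < plevel g (m k))%N,
        (plevel g (m k) < plevel f (n k.+1))%N,
        espan B (n k) (m k) ∘ pedge g (m k)
        ≅ pedge f (n k) ∘ espan C (plevel f (n k)) (plevel g (m k))
      & espan B (m k) (n k.+1) ∘ pedge f (n k.+1)
        ≅ pedge g (m k) ∘ espan C (plevel g (m k)) (plevel f (n k.+1))].

(** * The category of ordered Bratteli diagrams *)

Section EdgeIsoTheory.
Variables S T : finType.

Lemma edge_iso_refl (F : edge_set S T) : F ≅ F.
Proof. by exists id; split=> //; exists id. Qed.

Lemma edge_iso_sym (F G : edge_set S T) : F ≅ G -> G ≅ F.
Proof.
move=> [h [[h' hK h'K] hs hr hl]]; exists h'; split; first by exists h.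
- by move=> e; rewrite -hs h'K.
- by move=> e; rewrite -hr h'K.
- by move=> e e'; rewrite -hl !h'K.
Qed.

Lemma edge_iso_trans (F G H : edge_set S T) : F ≅ G -> G ≅ H -> F ≅ H.
Proof.
move=> [h [bh hs hr hl]] [k [bk ks kr kl]]; exists (k \o h); split.
- exact: bij_comp.
- by move=> e /=; rewrite ks hs.
- by move=> e /=; rewrite kr hr.
- by move=> e e' /=; rewrite kl hl.
Qed.

End EdgeIsoTheory.

Add Parametric Relation (S T : finType) : (edge_set S T) (@edge_iso S T)
  reflexivity proved by (@edge_iso_refl S T)
  symmetry proved by (@edge_iso_sym S T)
  transitivity proved by (@edge_iso_trans S T)
  as edge_iso_rel.

Lemma edge_isoI (S T : finType) (F G : edge_set S T) (h : F -> G) (k : G -> F) :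
  cancel h k -> cancel k h -> (forall e, src (h e) = src e) ->
  (forall e, rng (h e) = rng e) ->
  (forall e e', edge_le e e' = edge_le (h e) (h e')) -> F ≅ G.
Proof. by move=> hk kh hs hr hl; exists h; split=> //; exists k. Qed.

Definition epair (S T U : finType) (F : edge_set S T) (G : edge_set T U)
  (e : F) (g : G) (eg : rng e == src g) : F ∘ G := exist _ (e, g) eg.

Lemma ecomp_iso (S T U : finType) (F F' : edge_set S T) (G G' : edge_set T U) :
  F ≅ F' -> G ≅ G' -> F ∘ G ≅ F' ∘ G'.
Proof.
move=> [h [[h' hK h'K] hs hr hl]] [k [[k' kK k'K] ks kr kl]].
have P (p : F ∘ G) : rng (h (sval p).1) == src (k (sval p).2).
  by rewrite hr ks; case: p.
have Q (p : F' ∘ G') : rng (h' (sval p).1) == src (k' (sval p).2).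
  by rewrite -hr -ks h'K k'K; case: p.
apply: (@edge_isoI _ _ _ _ (fun p => epair (P p))
                           (fun p => epair (Q p))).
- by move=> [[e g] p]; apply: val_inj; rewrite /= hK kK.
- by move=> [[e g] p]; apply: val_inj; rewrite /= h'K k'K.
- by move=> p /=; rewrite hs.
- by move=> p /=; rewrite kr.
- move=> p q; rewrite /= /ecomp_le /= hl kl.
  by rewrite (inj_eq (can_inj kK)).
Qed.

#[global] Instance ecomp_mor (S T U : finType) :
  Morphisms.Proper (Morphisms.respectful (@edge_iso S T)
    (Morphisms.respectful (@edge_iso T U) (@edge_iso S U))) (@ecomp S T U).
Proof. by move=> F F' FF' G G' GG'; apply: ecomp_iso. Qed.

Lemma ecompA (S T U W : finType) (F : edge_set S T) (G : edge_set T U)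
  (H : edge_set U W) : F ∘ (G ∘ H) ≅ F ∘ G ∘ H.
Proof.
have P1 (p : F ∘ (G ∘ H)) : rng (sval p).1 == src (sval (sval p).2).1.
  by case: p.
pose h1 (p : F ∘ (G ∘ H)) : F ∘ G := epair (P1 p).
have P (p : F ∘ (G ∘ H)) : rng (h1 p) == src (sval (sval p).2).2.
  by case: p => [[e [[g h] q]] p].
have Q1 (p : F ∘ G ∘ H) : rng (sval (sval p).1).2 == src (sval p).2.
  by case: p.
pose h2 (p : F ∘ G ∘ H) : G ∘ H := epair (Q1 p).
have Q (p : F ∘ G ∘ H) : rng (sval (sval p).1).1 == src (h2 p).
  by case: p => [[[[e g] q] h] p].
apply: (@edge_isoI _ _ _ _ (fun p => epair (P p))
                           (fun p => epair (Q p))).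
- move=> [[e [[g h] q]] p]; apply: val_inj => /=; congr (_, _).
  exact: val_inj.
- move=> [[[[e g] q] h] p]; apply: val_inj => /=; congr (_, _).
  exact: val_inj.
- by [].
- by [].
- move=> [[e [[g h] q]] p] [[e' [[g' h'] q']] p'].
  rewrite /= /ecomp_le /= /ecomp_le /= -!val_eqE /= !xpair_eqE.
  by case: eqVneq; case: eqVneq => //=; rewrite ?orbF ?andbF.
Qed.

Lemma ediag_compl (V : nat -> finType) k (T : finType) (F : edge_set (V k) T) :
  ediag V k k ∘ F ≅ F.
Proof.
have P (e : F) : existT (fun n => V n : Type) k (src e) == existT _ k (src e).
  by [].
pose d e : ediag V k k := exist _ (_, _) (P e).
have Q (e : F) : rng (d e) == src e by [].
apply: (@edge_isoI _ _ (ediag V k k ∘ F) F (fun p => (sval p).2)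
  (fun e => @epair _ _ _ (ediag V k k) F (d e) e (Q e))).
- move=> [[[[v w] p] e] q] /=; apply: val_inj => /=; congr (_, _).
  apply: val_inj => /=; move: p q => /= /eqP p /eqP q; rewrite -q.
  congr (_, _); apply: (@eq_from_Tagged _ (fun n => V n : Type) k).
  by rewrite /Tagged p.
- by [].
- move=> [[[[v w] p] e] q] /=; move: p q => /= /eqP p /eqP q; rewrite -q.
  by apply: (@eq_from_Tagged _ (fun n => V n : Type) k); rewrite /Tagged p.
- by [].
- move=> p q /=; rewrite /ecomp_le; case: eqVneq => //= [eq2 | _]; last by rewrite orbF.
  rewrite eq2 edge_le_refl; apply/eqP.
  case: p q eq2 => [[[[v w] p] e] r] [[[[v' w'] p'] e'] r'] /= eq2.
  apply: val_inj => /=.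
  move: p r p' r' => /= /eqP p /eqP r /eqP p' /eqP r'.
  have ww : w = w' by rewrite r r' eq2.
  congr (_, _) => //; apply: (@eq_from_Tagged _ (fun n => V n : Type) k).
  by rewrite /Tagged p p' ww.
Qed.

Lemma ediag_compr (V : nat -> finType) k (S : finType) (F : edge_set S (V k)) :
  F ∘ ediag V k k ≅ F.
Proof.
have P (e : F) : existT (fun n => V n : Type) k (rng e) == existT _ k (rng e).
  by [].
pose d e : ediag V k k := exist _ (_, _) (P e).
have Q (e : F) : rng e == src (d e) by [].
apply: (@edge_isoI _ _ (F ∘ ediag V k k) F (fun p => (sval p).1)
  (fun e => @epair _ _ _ F (ediag V k k) e (d e) (Q e))).
- move=> [[e [[v w] p]] q] /=; apply: val_inj => /=; congr (_, _).
  apply: val_inj => /=; move: p q => /= /eqP p /eqP q; rewrite q.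
  congr (_, _); apply: (@eq_from_Tagged _ (fun n => V n : Type) k).
  by rewrite /Tagged p.
- by [].
- by [].
- move=> [[e [[v w] p]] q] /=; move: p q => /= /eqP p /eqP q; rewrite q.
  by apply: (@eq_from_Tagged _ (fun n => V n : Type) k); rewrite /Tagged p.
- move=> [[e [[v w] p]] r] [[e' [[v' w'] p']] r'] /=.
  rewrite /ecomp_le /=; case: eqVneq => //= ne; symmetry; apply/negP => ee'.
  case/eqP: ne; apply: val_inj => /=.
  move: p r p' r' => /= /eqP p /eqP r /eqP p' /eqP r'.
  have vv : v = v'.
    by rewrite -r -r'; apply/eqP; rewrite -edge_le_comparable ee'.
  congr (_, _) => //; apply: (@eq_from_Tagged _ (fun n => V n : Type) k).
  by rewrite /Tagged -p -p' vv.
Qed.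

Section SpanTheory.
Variable B : ordered_bratteli.

Lemma espan_diag k : espan B k k = ediag (vert B) k k.
Proof. by case: k => //= k; rewrite ltnn. Qed.

Lemma espanS k l : (k <= l)%N -> espan B k l.+1 = espan B k l ∘ edges B l.
Proof. by move=> /= ->. Qed.

Lemma espan1 k : espan B k k.+1 ≅ edges B k.
Proof. by rewrite espanS // espan_diag; apply: ediag_compl. Qed.

Lemma espan_cat k l m : (k <= l)%N -> (l <= m)%N ->
  espan B k l ∘ espan B l m ≅ espan B k m.
Proof.
move=> kl; elim: m => [|m IH].
  by case: l kl => // kl _; rewrite espan_diag; apply: ediag_compr.
rewrite leq_eqVlt => /orP[/eqP <-|lm].
  by rewrite (espan_diag l); apply: ediag_compr.
rewrite espanS // (espanS (leq_trans kl lm)).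
apply: edge_iso_trans (ecompA _ _ _) _.
exact: ecomp_iso (IH lm) (edge_iso_refl _).
Qed.

Lemma espan_src k l (v : vert B k) : (k <= l)%N ->
  exists e : espan B k l, src e = v.
Proof.
elim: l => [|l IH].
  case: k v => // v _.
  have P : existT (fun n => vert B n : Type) 0 v == existT _ 0 v by [].
  by exists (exist _ (v, v) P).
rewrite leq_eqVlt => /orP[/eqP <-|kl].
  rewrite espan_diag.
  have P : existT (fun n => vert B n : Type) k v == existT _ k v by [].
  by exists (exist _ (v, v) P).
rewrite espanS //; have [e ev] := IH kl.
have [e' e'e] := edges_src (rng e).
have P : rng e == src e' by rewrite e'e.
by exists (epair P).
Qed.

End SpanTheory.

Lemma plevel_mono (B C : ordered_bratteli) (f : premorphism B C) m n :
  (m <= n)%N -> (plevel f m <= plevel f n)%N.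
Proof.
elim: n => [|n IH]; first by case: m.
rewrite leq_eqVlt => /orP[/eqP -> //|mn].
exact: leq_trans (IH mn) (plevel_le f n).
Qed.

Lemma pedge_commute_span (B C : ordered_bratteli) (f : premorphism B C) k l :
  (k <= l)%N ->
  espan B k l ∘ pedge f l ≅ pedge f k ∘ espan C (plevel f k) (plevel f l).
Proof.
have dd m : espan B m m ∘ pedge f m
    ≅ pedge f m ∘ espan C (plevel f m) (plevel f m).
  rewrite !espan_diag; apply: edge_iso_trans (ediag_compl _) _.
  exact: edge_iso_sym (ediag_compr _).
elim: l => [|l IH]; first by case: k => // _; apply: dd.
rewrite leq_eqVlt => /orP[/eqP -> //|kl]; rewrite espanS // -ecompA.
rewrite pedge_commute ecompA IH // -ecompA espan_cat; first reflexivity.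
  exact: plevel_mono.
exact: plevel_le.
Qed.

Definition pequiv_at (B C : ordered_bratteli) (f g : premorphism B C) n m :=
  [/\ (n <= m)%N, (plevel f n <= plevel g m)%N
    & espan B n m ∘ pedge g m
      ≅ pedge f n ∘ espan C (plevel f n) (plevel g m)].

Section PequivTheory.
Variables B C : ordered_bratteli.
Implicit Types f g h : premorphism B C.

Lemma pequiv_at_refl f n : pequiv_at f f n n.
Proof. by split=> //; apply: pedge_commute_span. Qed.

Lemma pequiv_at_trans f g h n m p :
  pequiv_at f g n m -> pequiv_at g h m p -> pequiv_at f h n p.
Proof.
move=> [nm fg i1] [mp gh i2]; split; [exact: leq_trans mp|exact: leq_trans gh|].
rewrite -(espan_cat B nm mp) -ecompA i2 ecompA i1 -ecompA espan_cat //.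
reflexivity.
Qed.

Lemma pequiv_at_ge f g n m p :
  pequiv_at f g n m -> (m <= p)%N -> pequiv_at f g n p.
Proof.
move=> fg mp; apply: pequiv_at_trans fg _; split=> //; first exact: plevel_mono.
exact: pedge_commute_span.
Qed.

Lemma pequiv_at_le f g n m p :
  pequiv_at f g n m -> (p <= n)%N -> pequiv_at f g p m.
Proof.
move=> fg pn; apply: pequiv_at_trans fg; split=> //; first exact: plevel_mono.
exact: pedge_commute_span.
Qed.

Lemma pequivP f g : pequiv f g <->
  (forall n, exists m, pequiv_at f g n m) /\
  (forall n, exists m, pequiv_at g f n m).
Proof.
split=> [[n [m H]]|[H1 H2]].
  have n_ge k : (k <= n k)%N.
    elim: k => // k IH; have [[/andP[_ nm] mn] _ _ _ _] := H k.
    exact: leq_ltn_trans IH (ltn_trans nm mn).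
  split=> k; have [[/andP[_ nm] mn] fg gf i1 i2] := H k.
    exists (m k); apply: pequiv_at_le (n_ge k).
    by split=> //; apply: ltnW.
  exists (n k.+1); apply: (@pequiv_at_le _ _ (m k)).
    by split=> //; apply: ltnW.
  exact: leq_trans (n_ge k) (ltnW nm).
have next (u v : premorphism B C) : (forall n, exists m, pequiv_at u v n m) ->
    forall n, exists m,
    [/\ (n < m)%N, (plevel u n < plevel v m)%N & pequiv_at u v n m].
  move=> H n; have [m uv] := H n.
  have [p vp] := plevel_unbounded v (plevel u n).
  exists (maxn (maxn m p) n.+1); split.
  - exact: leq_maxr.
  - apply: leq_trans vp _; apply: plevel_mono.
    by rewrite -maxnA (leq_trans _ (leq_maxr _ _)) // leq_maxl.
  - by apply: pequiv_at_ge uv _; rewrite -maxnA leq_maxl.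
have /choice[a aP] := next _ _ H1; have /choice[b bP] := next _ _ H2.
pose n k := iter k (b \o a) 1%N; pose m k := a (n k).
have nm k : (n k < m k)%N by have [] := aP (n k).
have mn k : (m k < n k.+1)%N by have [] := bP (m k).
exists n, m => k.
have [_ lt1 [_ _ i1]] := aP (n k); have [_ lt2 [_ _ i2]] := bP (m k).
split=> //; split=> //; rewrite nm andbT.
by case: (k) => [|k'] //; apply: leq_ltn_trans (mn k').
Qed.

Lemma pequiv_refl f : pequiv f f.
Proof. by apply/pequivP; split=> n; exists n; apply: pequiv_at_refl. Qed.

Lemma pequiv_sym f g : pequiv f g -> pequiv g f.
Proof. by move=> /pequivP[H1 H2]; apply/pequivP. Qed.

Lemma pequiv_trans f g h : pequiv f g -> pequiv g h -> pequiv f h.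
Proof.
move=> /pequivP[fg gf] /pequivP[gh hg]; apply/pequivP; split=> n.
  have [m nm] := fg n; have [p mp] := gh m.
  by exists p; apply: pequiv_at_trans mp.
have [m nm] := hg n; have [p mp] := gf m.
by exists p; apply: pequiv_at_trans mp.
Qed.

End PequivTheory.

Section IdentityPremorphism.
Variable B : ordered_bratteli.

Let idl (n : nat) := n.

Lemma pid_unbounded M : exists n, (M < idl n)%N.
Proof. by exists M.+1. Qed.

Lemma espan_diag_src n (v : vert B n) : exists e : espan B n n, src e = v.
Proof. exact: espan_src. Qed.

Lemma espan_diag_rng n (v : vert B n) : exists e : espan B n n, rng e = v.
Proof.
rewrite espan_diag.
have P : existT (fun n => vert B n : Type) n v == existT _ n v by [].
by exists (exist _ (v, v) P).
Qed.

Lemma espan_diag_neq0 n : (0 < #|espan B n n|)%N.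
Proof.
have /card_gt0P[v _] := vert_neq0 B n.
by have [e _] := espan_diag_src v; apply/card_gt0P; exists e.
Qed.

Lemma espan00 : #|espan B 0 0| = 1%N.
Proof.
apply/eqP; rewrite eqn_leq espan_diag_neq0 andbT; apply/card_le1_eqP.
have /card_le1_eqP V1 : (#|vert B 0| <= 1)%N by rewrite vert0.
move=> [[v w] p] [[v' w'] p'] _ _; apply: val_inj => /=.
by congr (_, _); apply: V1.
Qed.

Lemma pid_commute n :
  edges B n ∘ espan B n.+1 n.+1 ≅ espan B n n ∘ espan B n n.+1.
Proof.
rewrite espan_cat // espan1 espan_diag; exact: ediag_compr.
Qed.

Definition pid : premorphism B B :=
  @Premorphism B B idl (fun n => espan B n n) (erefl 0%N)
    (fun n => leqnSn n) pid_unbounded espan_diag_neq0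
    espan_diag_src espan_diag_rng espan00 pid_commute.

End IdentityPremorphism.

Section PremorphismComposition.
Variables (B C D : ordered_bratteli).
Variables (g : premorphism C D) (f : premorphism B C).

Let hl n := plevel g (plevel f n).
Let h n : edge_set (vert B n) (vert D (hl n)) := pedge f n ∘ pedge g (plevel f n).

Lemma pcomp0 : hl 0 = 0%N.
Proof. by rewrite /hl (plevel0 f) plevel0. Qed.

Lemma pcomp_le n : (hl n <= hl n.+1)%N.
Proof. exact: plevel_mono (plevel_le f n). Qed.

Lemma pcomp_unbounded M : exists n, (M < hl n)%N.
Proof.
have [m Mm] := plevel_unbounded g M; have [n mn] := plevel_unbounded f m.
by exists n; apply: leq_trans Mm (plevel_mono g (ltnW mn)).
Qed.

Lemma pcomp_src n (v : vert B n) : exists e : h n, src e = v.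
Proof.
have [e ev] := pedge_src f v; have [e' e'e] := pedge_src g (rng e).
have P : rng e == src e' by rewrite e'e.
by exists (epair P).
Qed.

Lemma pcomp_rng n (w : vert D (hl n)) : exists e : h n, rng e = w.
Proof.
have [e ew] := pedge_rng w; have [e' e'e] := pedge_rng (src e).
have P : rng e' == src e by rewrite e'e.
by exists (epair P).
Qed.

Lemma pcomp_neq0 n : (0 < #|h n|)%N.
Proof.
have /card_gt0P[v _] := vert_neq0 B n.
by have [e _] := pcomp_src v; apply/card_gt0P; exists e.
Qed.

Lemma pcomp_card0 : #|h 0| = 1%N.
Proof.
apply/eqP; rewrite eqn_leq pcomp_neq0 andbT; apply/card_le1_eqP.
have /card_le1_eqP F1 : (#|pedge f 0| <= 1)%N by rewrite pedge0.
have /card_le1_eqP G1 : (#|pedge g (plevel f 0)| <= 1)%N.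
  by rewrite plevel0 pedge0.
move=> [[v w] p] [[v' w'] p'] _ _; apply: val_inj => /=.
by congr (_, _); [apply: F1 | apply: G1].
Qed.

Lemma pcomp_commute n :
  edges B n ∘ h n.+1 ≅ h n ∘ espan D (hl n) (hl n.+1).
Proof.
rewrite /h ecompA pedge_commute -!ecompA.
rewrite (pedge_commute_span g (plevel_le f n)); reflexivity.
Qed.

Definition pcomp : premorphism B D :=
  @Premorphism B D hl h pcomp0 pcomp_le pcomp_unbounded pcomp_neq0
    pcomp_src pcomp_rng pcomp_card0 pcomp_commute.

End PremorphismComposition.

Lemma pcomp_pequiv_at (B C D : ordered_bratteli) (g g' : premorphism C D)
    (f f' : premorphism B C) n m p :
  pequiv_at f f' n m -> pequiv_at g g' (plevel f n) p ->
  exists q, pequiv_at (pcomp g f) (pcomp g' f') n q.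
Proof.
move=> ff' gg'; have [q pq] := plevel_unbounded f' p.
pose r := maxn m q; exists r.
have [nr fr i1] := pequiv_at_ge ff' (leq_maxl m q).
have pr : (p <= plevel f' r)%N.
  by apply: leq_trans (ltnW pq) (plevel_mono f' (leq_maxr _ _)).
have [_ gr i2] := pequiv_at_ge gg' pr.
by split=> //=; rewrite ecompA i1 -!ecompA i2; reflexivity.
Qed.

Lemma pcomp_pequiv (B C D : ordered_bratteli) (g g' : premorphism C D)
    (f f' : premorphism B C) :
  pequiv g g' -> pequiv f f' -> pequiv (pcomp g f) (pcomp g' f').
Proof.
move=> /pequivP[g1 g2] /pequivP[f1 f2]; apply/pequivP; split=> n.
  have [m H] := f1 n; have [p H'] := g1 (plevel f n).
  exact: pcomp_pequiv_at H H'.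
have [m H] := f2 n; have [p H'] := g2 (plevel f' n).
exact: pcomp_pequiv_at H H'.
Qed.

Lemma pcompA (A B C D : ordered_bratteli) (h : premorphism C D)
    (g : premorphism B C) (f : premorphism A B) :
  pequiv (pcomp h (pcomp g f)) (pcomp (pcomp h g) f).
Proof.
apply/pequivP; split=> n; exists n; split=> //=; rewrite !espan_diag.
  by rewrite ediag_compl ediag_compr ecompA; reflexivity.
by rewrite ediag_compl ediag_compr ecompA; reflexivity.
Qed.

Lemma pcomp1 (B C : ordered_bratteli) (f : premorphism B C) :
  pequiv (pcomp f (pid B)) f.
Proof.
apply/pequivP; split=> n; exists n; split=> //=; rewrite !espan_diag.
  by rewrite !ediag_compl ediag_compr; reflexivity.
by rewrite !ediag_compl ediag_compr; reflexivity.
Qed.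

Lemma p1comp (B C : ordered_bratteli) (f : premorphism B C) :
  pequiv (pcomp (pid C) f) f.
Proof.
apply/pequivP; split=> n; exists n; split=> //=; rewrite !espan_diag.
  by rewrite !ediag_compl !ediag_compr; reflexivity.
by rewrite !ediag_compl !ediag_compr; reflexivity.
Qed.

(** Morphisms are equivalence classes of premorphisms; composition goes through
    chosen representatives, and [obd_compE] shows that it is independent of
    the choice. *)
Definition obd_hom (B C : ordered_bratteli) : Type :=
  {A : premorphism B C -> Prop | exists f, A = pequiv f}.

Definition pclass (B C : ordered_bratteli) (f : premorphism B C) :
    obd_hom B C := exist _ (pequiv f) (ex_intro _ f erefl).

Lemma pclass_eq (B C : ordered_bratteli) (f g : premorphism B C) :
  pclass f = pclass g <-> pequiv f g.
Proof.
split=> [/(congr1 sval) /= -> | fg]; first exact: pequiv_refl.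
apply: eq_exist; apply/funext => h; apply/propext; split.
  exact: pequiv_trans (pequiv_sym fg).
exact: pequiv_trans fg.
Qed.

Definition prepr (B C : ordered_bratteli) (a : obd_hom B C) :
    premorphism B C := sval (cid (svalP a)).

Lemma preprK (B C : ordered_bratteli) (a : obd_hom B C) :
  pclass (prepr a) = a.
Proof.
rewrite /prepr; case: cid => f /= af; case: a af => A pA /= af.
by apply: eq_exist; rewrite af.
Qed.

Definition obd_comp (B C D : ordered_bratteli) (b : obd_hom C D)
  (a : obd_hom B C) : obd_hom B D := pclass (pcomp (prepr b) (prepr a)).

Lemma obd_compE (B C D : ordered_bratteli) (g : premorphism C D)
    (f : premorphism B C) :
  obd_comp (pclass g) (pclass f) = pclass (pcomp g f).
Proof. by apply/pclass_eq/pcomp_pequiv; apply/pclass_eq; rewrite preprK. Qed.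

Lemma obd_compA (A B C D : ordered_bratteli) (c : obd_hom C D)
    (b : obd_hom B C) (a : obd_hom A B) :
  obd_comp c (obd_comp b a) = obd_comp (obd_comp c b) a.
Proof.
by rewrite -[a]preprK -[b]preprK -[c]preprK !obd_compE; apply/pclass_eq/pcompA.
Qed.

Lemma obd_comp1 (B C : ordered_bratteli) (a : obd_hom B C) :
  obd_comp a (pclass (pid B)) = a.
Proof. by rewrite -[a]preprK obd_compE; apply/pclass_eq/pcomp1. Qed.

Lemma obd_1comp (B C : ordered_bratteli) (a : obd_hom B C) :
  obd_comp (pclass (pid C)) a = a.
Proof. by rewrite -[a]preprK obd_compE; apply/pclass_eq/p1comp. Qed.

Definition OBD : category :=
  @Category ordered_bratteli obd_hom (fun B => pclass (pid B)) obd_comp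
    obd_compA obd_comp1 obd_1comp.

Definition OBD_po : category := full_subcategory (C := OBD) properly_ordered.

(** * Scaled essentially minimal dynamical systems *)

Definition homeomorphism (X Y : topologicalType) (f : X -> Y) : Prop :=
  continuous f /\
  exists g : Y -> X, [/\ continuous g, cancel f g & cancel g f].

Definition homeomorphic (X Y : topologicalType) : Prop :=
  exists f : X -> Y, homeomorphism f.

Definition metrizable (R : realType) (X : topologicalType) : Prop :=
  exists M : metricType R, homeomorphic X M.

Definition closed_invariant (X : topologicalType) (phi : X -> X) (M : set X) :
    Prop := [/\ M !=set0, closed M & phi @` M = M].

Definition minimal_subset (X : topologicalType) (phi : X -> X) (M : set X) :
    Prop :=
  closed_invariant phi M /\
  forall N, closed_invariant phi N -> N `<=` M -> N = M.

(** The towers are part of the data, since the top is not determined by the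
    underlying set partition.  Floors are indexed from [0]: the [j]-th floor of
    tower [k] is usually written Z(k, j + 1). *)
Record kr_partition (X : topologicalType) (phi : X -> X) (x0 : X) :=
KRPartition {
  kr_num : nat;
  kr_height : 'I_kr_num -> nat;
  kr_set : forall k, 'I_(kr_height k) -> set X;
  kr_top := [set x | exists k (j : 'I_(kr_height k)),
                       j.+1 = kr_height k /\ kr_set j x];
  kr_bottom := [set x | exists k (j : 'I_(kr_height k)),
                          j = 0 :> nat /\ kr_set j x];
  kr_height_gt0 : forall k, (0 < kr_height k)%N;
  kr_neq0 : forall k (j : 'I_(kr_height k)), kr_set j !=set0;
  kr_clopen : forall k (j : 'I_(kr_height k)), clopen (kr_set j);
  kr_cover : forall x, exists k (j : 'I_(kr_height k)), kr_set j x;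
  kr_disjoint : trivIset setT
    (fun i : {k : 'I_kr_num & 'I_(kr_height k)} => kr_set (tagged i));
  kr_next : forall k (i j : 'I_(kr_height k)),
    j = i.+1 :> nat -> phi @` kr_set i = kr_set j;
  kr_top_base : kr_top x0;
  kr_top_bottom : phi @` kr_top = kr_bottom }.

Arguments kr_num {X phi x0} _.
Arguments kr_height {X phi x0} _ _.
Arguments kr_set {X phi x0} _ {k} _ _.
Arguments kr_top {X phi x0} _ _.
Arguments kr_bottom {X phi x0} _ _.

Definition kr_atoms (X : topologicalType) (phi : X -> X) (x0 : X)
    (P : kr_partition phi x0) : set (set X) :=
  [set A | exists k (j : 'I_(kr_height P k)), A = kr_set P j].

Record kr_system (X : topologicalType) (phi : X -> X) (x0 : X) := KRSystem {
  kr_part :> nat -> kr_partition phi x0;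
  kr_part0 : kr_atoms (kr_part 0) = [set [set: X]];
  kr_refine : forall n A, kr_atoms (kr_part n.+1) A ->
    exists2 A', kr_atoms (kr_part n) A' & A `<=` A';
  kr_top_decreasing : forall n, (0 < n)%N ->
    kr_top (kr_part n.+1) `<=` kr_top (kr_part n);
  kr_top_bigcap :
    \bigcap_(n in [set n | (0 < n)%N]) kr_top (kr_part n) = [set x0];
  kr_basis : basis (\bigcup_n kr_atoms (kr_part n)) }.

Record sds_object (R : realType) := SDSObject {
  sds_space :> topologicalType;
  sds_map : sds_space -> sds_space;
  sds_base : sds_space;
  sds_kr : kr_system sds_map sds_base;
  sds_metrizable : metrizable R sds_space;
  sds_compact : compact [set: sds_space];
  sds_totally_disconnected : totally_disconnected [set: sds_space];
  sds_homeo : homeomorphism sds_map;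
  sds_ess_minimal : exists! M, minimal_subset sds_map M;
  sds_base_minimal : exists2 M, minimal_subset sds_map M & M sds_base }.

Section SDSCategory.
Variable R : realType.

Definition sds_hom (X Y : sds_object R) : Type :=
  {alpha : X -> Y |
    [/\ continuous alpha,
        forall x, alpha (sds_map x) = sds_map (alpha x)
      & alpha (sds_base X) = sds_base Y]}.

Lemma sds_hom_eq (X Y : sds_object R) (a b : sds_hom X Y) :
  sval a = sval b -> a = b.
Proof. by case: a b => [a Pa] [b Pb] /= ab; apply: eq_exist. Qed.

Lemma sds_id_subproof (X : sds_object R) :
  [/\ continuous (@id X), forall x : X, id (sds_map x) = sds_map (id x)
    & id (sds_base X) = sds_base X].
Proof. by split=> // x. Qed.

Definition sds_id (X : sds_object R) : sds_hom X X :=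
  exist _ id (sds_id_subproof X).

Lemma sds_comp_subproof (X Y Z : sds_object R) (b : sds_hom Y Z)
    (a : sds_hom X Y) :
  [/\ continuous (sval b \o sval a),
      forall x, (sval b \o sval a) (sds_map x) = sds_map ((sval b \o sval a) x)
    & (sval b \o sval a) (sds_base X) = sds_base Z].
Proof.
case: a b => [a [ca ea xa]] [b [cb eb xb]] /=; split.
- by move=> x; apply: continuous_comp; [apply: ca | apply: cb].
- by move=> x /=; rewrite ea eb.
- by rewrite /= xa xb.
Qed.

Definition sds_comp (X Y Z : sds_object R) (b : sds_hom Y Z)
    (a : sds_hom X Y) : sds_hom X Z := exist _ _ (sds_comp_subproof b a).

Lemma sds_compA (X Y Z T : sds_object R) (c : sds_hom Z T) (b : sds_hom Y Z)
    (a : sds_hom X Y) :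
  sds_comp c (sds_comp b a) = sds_comp (sds_comp c b) a.
Proof. exact: sds_hom_eq. Qed.

Lemma sds_comp1 (X Y : sds_object R) (a : sds_hom X Y) :
  sds_comp a (sds_id X) = a.
Proof. exact: sds_hom_eq. Qed.

Lemma sds_1comp (X Y : sds_object R) (a : sds_hom X Y) :
  sds_comp (sds_id Y) a = a.
Proof. exact: sds_hom_eq. Qed.

Definition SDS : category :=
  @Category (sds_object R) sds_hom sds_id sds_comp
    sds_compA sds_comp1 sds_1comp.

End SDSCategory.

Definition cantor_minimal (R : realType) (X : sds_object R) : Prop :=
  homeomorphic X cantor_space /\ minimal_subset (@sds_map R X) [set: X].

(* Main.v *)
Require Import Defs.
From HB Require Import structures.
From mathcomp Require Import all_boot order ssralg ssrnum.
From mathcomp Require Import boolp classical_sets functions cardinality.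
From mathcomp Require Import reals topology cantor.

(** Up to isomorphism an ordered edge set from [S] to [T] is a family of words:
    to [t] in [T] it associates the list of the sources of the edges with range
    [t], in increasing order.  Isomorphism is equality of words ([edge_isoP])
    and composition is substitution ([word_ecomp]).  An ordered Bratteli
    diagram is thus a recipe for stacking the towers of level [n + 1] from the
    towers of level [n].

    A [model] of a diagram [B] is a system whose points are located, level by
    level, on the floors of such towers; the map climbs the towers, and the
    base point is the only point on a top floor at every level.  Let [X] and
    [Y] be models of [B] and [C].  An equivariant map [a] from [Y] to [X]
    preserving the base points sends, for [m] large with respect to [n], every
    tower of level [m] over a stack of complete towers of level [n], because
    the orbit of a bottom floor up to the top floor of its tower starts at a
    bottom floor and ends at a top floor.  Reading these stacks gives edge sets
    that describe [a] ([describes_exists]).  The edge set describing a map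
    between two given levels is unique up to isomorphism ([describes_inj]), and
    descriptions compose ([describes_ecomp]).  Hence [a] is induced by a
    premorphism from [B] to [C] ([map_premorphism]), unique up to equivalence
    ([induces_pequiv]).  Conversely a premorphism sends the coherent sequence of
    floors of a point of [Y] to a coherent sequence of floors in [X], and by
    compactness the latter comes from a point ([premorphism_map]); equivalent
    premorphisms induce the same map ([pequiv_induces]).

    Every system with Kakutani-Rokhlin partitions is a model of the diagram of
    these partitions ([kr_model]).  If the system is minimal and infinite, the
    diagram is properly ordered, since the tops shrink to the base point
    ([model_properly_ordered]), it is simple, by recurrence ([model_simple]),
    and it has infinitely many paths ([model_infinite_paths]).  Conversely the
    path space of a simple properly ordered diagram with infinitely many paths,
    with the Vershik map, is a model of the diagram; it is minimal
    ([simple_minimal]), hence without isolated points, hence a Cantor set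
    ([diagram_object]).  Choosing for each system a diagram that it models, and
    for each map a premorphism that induces it, gives the functor. *)

Set Implicit Arguments.
Unset Strict Implicit.
Unset Printing Implicit Defensive.

Import Order.TTheory GRing.Theory Num.Theory.

Local Open Scope classical_set_scope.


(** * Preliminaries *)

Lemma dep_choice (I : Type) (T : I -> Type) (P : forall i, T i -> Prop) :
  (forall i, exists x, P i x) -> exists f, forall i, P i (f i).
Proof.
by move=> H; exists (fun i => sval (cid (H i))) => i; exact: (svalP (cid (H i))).
Qed.

Lemma infinite_inj (T U : Type) (f : T -> U) (A : set U) :
  injective f -> (forall x, A (f x)) -> infinite_set [set: T] -> infinite_set A.
Proof.
move=> f_inj fA Tinf Afin; apply: Tinf.
have [x0|T0] := pselect (inhabited T); last first.
  have -> : [set: T] = set0 by apply/seteqP; split=> // x; case: T0.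
  exact: finite_set0.
have /choice[k kP] : forall u, exists x, (exists y, f y = u) -> f x = u.
  move=> u; have [[y yu]|H] := pselect (exists y, f y = u); first by exists y.
  by case: x0 => x; exists x => /H.
apply: sub_finite_set (finite_image k Afin) => x _.
by exists (f x) => //; apply: f_inj; apply: kP; exists x.
Qed.

(** * Concatenated towers *)

Section Expand.
Variables (V : Type) (h : V -> nat).

(** The floors met while climbing, one after the other, the towers listed in
    [w]; the floors of the tower [v] are the pairs [(v, i)] with [i < h v]. *)
Definition expand (w : seq V) : seq (V * nat) :=
  flatten [seq [seq (v, i) | i <- iota 0 (h v)] | v <- w].

(** [c'] can follow [c] along an orbit: one floor up inside a tower, or from
    the top floor of a tower to the bottom floor of any tower. *)
Definition step (c c' : V * nat) : Prop :=
  (c.2.+1 < h c.1)%N /\ c' = (c.1, c.2.+1) \/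
  c.2.+1 = h c.1 /\ c'.2 = 0%N.

Lemma expand_cons v w :
  expand (v :: w) = [seq (v, i) | i <- iota 0 (h v)] ++ expand w.
Proof. by []. Qed.

Lemma expand_cat w w' : expand (w ++ w') = expand w ++ expand w'.
Proof. by rewrite /expand map_cat flatten_cat. Qed.

Lemma size_expand_cons v w : size (expand (v :: w)) = (h v + size (expand w))%N.
Proof. by rewrite expand_cons size_cat size_map size_iota. Qed.

Lemma onth_block v j : onth [seq (v, i) | i <- iota 0 (h v)] j =
  if (j < h v)%N then Some (v, j) else None.
Proof.
rewrite onth_map; case: ltnP => jh; last by rewrite onth_default ?size_iota.
have := onthTE (iota 0 (h v)) j; rewrite size_iota jh.
by have := odflt_onth 0 (iota 0 (h v)) j; rewrite nth_iota //; case: onth => [i|] //= ->.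
Qed.

Lemma onth_expand_cons v w j : onth (expand (v :: w)) j =
  if (j < h v)%N then Some (v, j) else onth (expand w) (j - h v).
Proof.
by rewrite expand_cons onth_cat size_map size_iota onth_block; case: ltnP.
Qed.

Lemma expand_lt w j c : onth (expand w) j = Some c -> (c.2 < h c.1)%N.
Proof.
elim: w j => [|v w IH] j; first by rewrite onth0n.
by rewrite onth_expand_cons; case: ltnP => [jh [<-]|_] //; apply: IH.
Qed.

Lemma expand_bottom w c : (forall v, 0 < h v)%N ->
  onth (expand w) 0 = Some c -> c.2 = 0%N.
Proof.
by move=> h0; case: w => [|v w] //; rewrite onth_expand_cons h0 => -[<-].
Qed.

Lemma expand_top w j c : (forall v, 0 < h v)%N -> j.+1 = size (expand w) ->
  onth (expand w) j = Some c -> c.2.+1 = h c.1.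
Proof.
move=> h0; elim: w j => [|v w IH] j //; rewrite size_expand_cons onth_expand_cons.
case: ltnP => [jh jE [<-] /=|hj jE]; last by apply: IH; rewrite -subSn // jE addKn.
by apply/eqP; rewrite eqn_leq jh jE leq_addr.
Qed.

(** The top floor of the last tower, and the bottom floor of the first. *)
Lemma expand_last w j c v : (forall v, 0 < h v)%N -> j.+1 = size (expand w) ->
  onth (expand w) j = Some c -> c.1 = last v w.
Proof.
move=> h0; elim: w j v => [|u w IH] j v //=.
rewrite size_expand_cons onth_expand_cons.
case: ltnP => [jh jE [<-] /=|hj jE]; last by apply: IH; rewrite -subSn // jE addKn.
case: w {IH} jE => // u' w jE; move: jh.
by rewrite jE size_expand_cons leqNgt -[X in (X < _)%N]addn0 ltn_add2l addn_gt0 h0.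
Qed.

Lemma expand_head w c v : (forall v, 0 < h v)%N ->
  onth (expand w) 0 = Some c -> c.1 = head v w.
Proof. by move=> h0; case: w => [|u w] //; rewrite onth_expand_cons h0 => -[<-]. Qed.

Lemma expand_step w j c c' : (forall v, 0 < h v)%N ->
  onth (expand w) j = Some c -> onth (expand w) j.+1 = Some c' -> step c c'.
Proof.
move=> h0; elim: w j => [|v w IH] j //; rewrite !onth_expand_cons.
case: (ltnP j (h v)) => [jh [<-]|hj]; last first.
  by rewrite ltnNge (leq_trans hj (leqnSn _)) /= subSn //; apply: IH.
case: ltnP => [jh' [<-]|hj']; first by left.
have jE : j.+1 = h v by apply/eqP; rewrite eqn_leq jh.
by rewrite jE subnn => /(expand_bottom h0); right.
Qed.

(** The towers are read off from the bottom floors, so that [expand] is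
    injective. *)
Lemma expandK w : (forall v, 0 < h v)%N ->
  [seq c.1 | c <- expand w & c.2 == 0] = w.
Proof.
have E v a k : [seq c.1 | c <- [seq (v, i) | i <- iota a.+1 k] & c.2 == 0] = [::].
  by elim: k a => //=.
move=> h0; elim: w => [|v w IH] //.
rewrite expand_cons filter_cat map_cat IH; case: (h v) (h0 v) => // k _.
by rewrite [in iota _ _]/= map_cons /= E.
Qed.

Lemma expand_inj w w' : (forall v, 0 < h v)%N ->
  expand w = expand w' -> w = w'.
Proof. by move=> h0 ww; rewrite -(expandK w h0) ww expandK. Qed.

Lemma step_expand_from (f : nat -> V * nat) n a : (forall v, 0 < h v)%N ->
  (forall i, (a <= i < a + n)%N -> step (f i) (f i.+1)) ->
  (f (a + n)%N).2.+1 = h (f (a + n)%N).1 -> ((f a).2 < h (f a).1)%N ->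
  [seq f i | i <- iota a n.+1] =
  [seq ((f a).1, i) | i <- iota (f a).2 (h (f a).1 - (f a).2)] ++
  expand [seq c.1 | c <- [seq f i | i <- iota a.+1 n] & c.2 == 0].
Proof.
move=> h0; elim: n a => [|n IH] a fS ft fa.
  by move: ft; rewrite addn0 => ft; rewrite /= -ft subSnn /= -surjective_pairing.
have {}IH := IH a.+1; rewrite addSnnS in IH.
have aa : (a <= a < a + n.+1)%N by rewrite leqnn addnS ltnS leq_addr.
have ltS : ((f a.+1).2 < h (f a.+1).1)%N.
  by have [[lt ->]|[_ ->]] := fS a aa.
rewrite -[iota a n.+2]/(a :: iota a.+1 n.+1) map_cons [in LHS]IH //; last first.
  by move=> i /andP[ai ilt]; apply: fS; rewrite (ltnW ai).
rewrite -[iota a.+1 n.+1]/(a.+1 :: iota a.+2 n) map_cons.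
have [[lt ->]|[ft1 fb]] := fS a aa.
  have hE : (h (f a).1 - (f a).2 = (h (f a).1 - (f a).2.+1).+1)%N.
    by rewrite -subSn ?(ltnW lt) // subSS.
  by rewrite hE /= -surjective_pairing.
rewrite /= fb eqxx subn0 /= -ft1 subSnn /= -surjective_pairing.
by rewrite expand_cons.
Qed.

(** A finite stretch of an orbit that enters at a bottom floor and leaves from
    a top floor climbs complete towers. *)
Lemma step_expand (f : nat -> V * nat) n : (forall v, 0 < h v)%N ->
  (forall i, (i.+1 < n)%N -> step (f i) (f i.+1)) -> (0 < n)%N ->
  (f 0).2 = 0%N -> (f n.-1).2.+1 = h (f n.-1).1 ->
  [seq f i | i <- iota 0 n] =
  expand [seq c.1 | c <- [seq f i | i <- iota 0 n] & c.2 == 0].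
Proof.
case: n => // n h0 fS _ fb ft.
rewrite {1}step_expand_from ?fb ?subn0 //= ?fb //.
Qed.

End Expand.

Lemma expand_map (V W : Type) (g : V -> W) (h : W -> nat) (w : seq V) :
  expand h (map g w) = [seq (g c.1, c.2) | c <- expand (h \o g) w].
Proof.
elim: w => // v w IH; rewrite map_cons !expand_cons map_cat IH -map_comp.
by congr (_ ++ _).
Qed.

Lemma expand_mem (V : eqType) (h : V -> nat) w j c :
  onth (expand h w) j = Some c -> c.1 \in w.
Proof.
elim: w j => [|v w IH] j; first by rewrite onth0n.
rewrite onth_expand_cons inE; case: ltnP => [_ [<-]|_ /IH ->] /=.
  by rewrite eqxx.
by rewrite orbT.
Qed.

Lemma expand_uniq (V : eqType) (h : V -> nat) (w : seq V) :
  uniq w -> uniq (expand h w).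
Proof.
elim: w => // v w IH /= /andP[vw uw]; rewrite expand_cons cat_uniq IH // andbT.
rewrite map_inj_uniq ?iota_uniq //=; last by move=> i j [].
apply/hasPn => c /flattenP[b /mapP[u uw' ->] /mapP[i _ ->]].
by apply/mapP => -[j _ [uv _]]; rewrite -uv uw' in vw.
Qed.

Lemma mem_expand (V : eqType) (h : V -> nat) w v i :
  ((v, i) \in expand h w) = (v \in w) && (i < h v)%N.
Proof.
apply/flatten_mapP/andP => [[u uw /mapP[k]]|[vw ih]].
  by rewrite mem_iota => /andP[_ kh] [-> ->].
by exists v => //; apply/mapP; exists i => //; rewrite mem_iota.
Qed.

Lemma onth_index (T : eqType) (s : seq T) x :
  x \in s -> onth s (index x s) = Some x.
Proof.
move=> xs; have := onthTE s (index x s); rewrite index_mem xs.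
by have := odflt_onth x s (index x s); rewrite nth_index //; case: onth => //= y ->.
Qed.

Section IndexExpand.
Variables (V : eqType) (h : V -> nat).
Hypothesis h0 : forall v, (0 < h v)%N.

Lemma index_expand_top w v i : uniq w -> v \in w -> last v w = v ->
  i.+1 = h v -> (index (v, i) (expand h w)).+1 = size (expand h w).
Proof.
move=> uw vw lv iv; have m : (v, i) \in expand h w by rewrite mem_expand vw -iv /=.
have s0 : (0 < size (expand h w))%N by case: (expand h w) m.
have [c cE] : exists c, onth (expand h w) (size (expand h w)).-1 = Some c.
  have := onthTE (expand h w) (size (expand h w)).-1.
  by rewrite prednK // leqnn; case: onth => // c; exists c.
have ct := expand_top h0 (prednK s0) cE.
have cl := expand_last v h0 (prednK s0) cE; rewrite lv in cl.
have -> : (v, i) = c.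
  rewrite [RHS]surjective_pairing cl; congr (_, _); apply/eqP.
  by rewrite -eqSS iv -cl ct.
rewrite -(onth_nth c _ _ _ cE) index_uniq ?prednK //.
exact: expand_uniq.
Qed.

Lemma index_expand_bottom w v i : v \in w -> head v w = v ->
  i = 0%N -> index (v, i) (expand h w) = 0%N.
Proof.
case: w => //= u w _ -> ->; rewrite expand_cons.
by case: (h v) (h0 v) => //= k _; rewrite eqxx.
Qed.

End IndexExpand.

(** Climbing the towers of [T], each cut into towers of [S] by [w], locates a
    floor in two stages. *)
Lemma onth_expand_flatten (S T : Type) (hS : S -> nat) (hT : T -> nat)
    (w : T -> seq S) (u : seq T) j :
  (forall t, hT t = size (expand hS (w t))) ->
  onth (expand hS (flatten (map w u))) j =
  obind (fun c => onth (expand hS (w c.1)) c.2) (onth (expand hT u) j).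
Proof.
move=> hTw; elim: u j => [|t u IH] j; first by rewrite !onth0n.
rewrite /= expand_cat onth_cat onth_expand_cons hTw; case: ltnP => // _.
Qed.

Lemma size_expand_flatten (S T : Type) (hS : S -> nat) (hT : T -> nat)
    (w : T -> seq S) (u : seq T) :
  (forall t, hT t = size (expand hS (w t))) ->
  size (expand hS (flatten (map w u))) = size (expand hT u).
Proof.
move=> hTw; elim: u => // t u IH.
by rewrite /= expand_cat size_cat size_expand_cons hTw IH.
Qed.

(** * Ordered edge sets as families of words *)

Section Word.
Variables (S T : finType).

(** The edges with range [t], in increasing order. *)
Definition fiber (F : edge_set S T) (t : T) : seq F :=
  sort (@edge_le _ _ F) [seq e <- enum F | rng e == t].

(** The sources of the edges with range [t], in increasing order. *)
Definition word (F : edge_set S T) (t : T) : seq S := map (@src _ _ F) (fiber F t).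

Variable F : edge_set S T.

Lemma mem_fiber t (e : F) : (e \in fiber F t) = (rng e == t).
Proof. by rewrite mem_sort mem_filter mem_enum andbT. Qed.

Lemma fiber_uniq t : uniq (fiber F t).
Proof. by rewrite sort_uniq filter_uniq ?enum_uniq. Qed.

Lemma fiber_sorted t : sorted (@edge_le _ _ F) (fiber F t).
Proof.
apply: (@sort_sorted_in _ [pred e | rng e == t]).
  by move=> e e' /eqP et /eqP et'; rewrite edge_le_comparable et et'.
by rewrite all_filter; apply/allP => e _ /=; apply/implyP.
Qed.

Lemma fiberP t (s : seq F) : sorted (@edge_le _ _ F) s -> uniq s ->
  (forall e, (e \in s) = (rng e == t)) -> fiber F t = s.
Proof.
move=> ss us sE; apply: (sorted_eq (@edge_le_trans _ _ F) (@edge_le_anti _ _ F)) => //.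
  exact: fiber_sorted.
by apply: uniq_perm => // [|e]; rewrite ?fiber_uniq // mem_fiber sE.
Qed.

Lemma edge_le_index (e e' : F) : edge_le e e' =
  (rng e == rng e') && (index e (fiber F (rng e)) <= index e' (fiber F (rng e)))%N.
Proof.
case: eqVneq => /= [ee|/eqP ne]; last first.
  by apply/negP => ee; apply: ne; apply/eqP; rewrite -edge_le_comparable ee.
have [m m'] : e \in fiber F (rng e) /\ e' \in fiber F (rng e).
  by rewrite !mem_fiber ee eqxx.
have idx := sorted_leq_index (@edge_le_trans _ _ F) (@edge_le_refl _ _ F) (fiber_sorted (rng e)).
apply/idP/idP => [le|]; last exact: idx.
rewrite leqNgt; apply/negP => /[dup] lt /ltnW /idx ge.
by move: lt; rewrite (edge_le_anti (x := e) (y := e')) ?ltnn // le ge.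
Qed.

Lemma maximal_edge_last (e : F) :
  maximal_edge e <-> last e (fiber F (rng e)) = e.
Proof.
have eF : e \in fiber F (rng e) by rewrite mem_fiber.
split=> [me|le e' ee'].
  apply: me; rewrite edge_le_index.
  have lF : last e (fiber F (rng e)) \in fiber F (rng e).
    by case: (fiber F _) eF => //= a s _; exact: mem_last.
  move: (lF); rewrite mem_fiber => /eqP ->; rewrite eqxx /=.
  case: (fiber F _) eF (fiber_uniq (rng e)) => // a s eF us.
  by rewrite -[last e _]/(last a s) (index_last us) -ltnS -[(size s).+1]/(size (a :: s)) index_mem.
have rr : rng e' = rng e.
  by apply/esym/eqP; rewrite -edge_le_comparable ee'.
have e'F : e' \in fiber F (rng e) by rewrite mem_fiber rr.
apply: (edge_le_anti (x := e') (y := e)); rewrite ee' andbT edge_le_index rr eqxx /=.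
rewrite -{2}le; case: (fiber F _) e'F (fiber_uniq (rng e)) => // a s e'F us.
by rewrite -[last e _]/(last a s) (index_last us) -ltnS -[(size s).+1]/(size (a :: s)) index_mem.
Qed.

Lemma minimal_edge_head (e : F) :
  minimal_edge e <-> head e (fiber F (rng e)) = e.
Proof.
have eF : e \in fiber F (rng e) by rewrite mem_fiber.
split=> [me|le e' ee'].
  apply: me; rewrite edge_le_index.
  have lF : head e (fiber F (rng e)) \in fiber F (rng e).
    by case: (fiber F _) eF => // a s _; rewrite inE eqxx.
  move: (lF); rewrite mem_fiber => /eqP ->; rewrite eqxx /=.
  by case: (fiber F _) eF => //= a s _; rewrite eqxx.
have rr : rng e' = rng e.
  by apply/eqP; rewrite -edge_le_comparable ee'.
have e'F : e' \in fiber F (rng e) by rewrite mem_fiber rr.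
apply: (edge_le_anti (x := e') (y := e)); rewrite ee' edge_le_index rr eqxx /=.
by rewrite -{1}le; case: (fiber F _) e'F => //= a s _; rewrite eqxx.
Qed.

End Word.

Lemma maximal_edge_inj (S T : finType) (F : edge_set S T) (e e' : F) :
  maximal_edge e -> maximal_edge e' -> rng e = rng e' -> e = e'.
Proof.
move=> me me' ee; have := edge_le_comparable e e'; rewrite ee eqxx.
by move=> /orP[/me|/me'].
Qed.

Lemma minimal_edge_inj (S T : finType) (F : edge_set S T) (e e' : F) :
  minimal_edge e -> minimal_edge e' -> rng e = rng e' -> e = e'.
Proof.
move=> me me' ee; have := edge_le_comparable e e'; rewrite ee eqxx.
by move=> /orP[/me'|/me].
Qed.

Lemma maximal_edge_exists (S T : finType) (F : edge_set S T) (e : F) :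
  exists2 e' : F, rng e' = rng e & maximal_edge e'.
Proof.
have eF : e \in fiber F (rng e) by rewrite mem_fiber.
have rE : rng (last e (fiber F (rng e))) = rng e.
  by apply/eqP; rewrite -mem_fiber; case: (fiber _ _) eF => //= a s _; exact: mem_last.
exists (last e (fiber F (rng e))) => //; apply/maximal_edge_last; rewrite rE.
by case: (fiber _ _) eF.
Qed.

Lemma minimal_edge_exists (S T : finType) (F : edge_set S T) (e : F) :
  exists2 e' : F, rng e' = rng e & minimal_edge e'.
Proof.
have eF : e \in fiber F (rng e) by rewrite mem_fiber.
have rE : rng (head e (fiber F (rng e))) = rng e.
  by apply/eqP; rewrite -mem_fiber; case: (fiber _ _) eF => //= a s _; rewrite inE eqxx.
exists (head e (fiber F (rng e))) => //; apply/minimal_edge_head; rewrite rE.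
by case: (fiber _ _) eF.
Qed.

Section WordEdges.
Variables (S T : finType) (w : T -> seq S).

Let wedge_edge : finType := {t : T & 'I_(size (w t))}.

Let wedge_src (e : wedge_edge) : S := tnth (in_tuple (w (tag e))) (tagged e).

Let wedge_le : rel wedge_edge := fun e e' =>
  (tag e == tag e') && (tagged e <= tagged e')%N.

Let wedge_inj (e e' : wedge_edge) :
  tag e = tag e' -> tagged e = tagged e' :> nat -> e = e'.
Proof.
case: e e' => [t i] [t' i'] /= tt; case: _ / tt i' => i' ii.
by congr existT; apply: val_inj.
Qed.

Let wedge_le_refl : reflexive wedge_le.
Proof. by move=> e; rewrite /wedge_le eqxx leqnn. Qed.

Let wedge_le_anti : antisymmetric wedge_le.
Proof.
move=> e e' /andP[/andP[/eqP tt le] /andP[_ ge]]; apply: wedge_inj => //.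
by apply/eqP; rewrite eqn_leq le.
Qed.

Let wedge_le_trans : transitive wedge_le.
Proof.
move=> e e' e'' /andP[/eqP t1 le1] /andP[/eqP t2 le2].
by apply/andP; split; [rewrite t1 t2|exact: leq_trans le1 le2].
Qed.

Let wedge_le_comparable e e' : wedge_le e e' || wedge_le e' e = (tag e == tag e').
Proof.
by rewrite /wedge_le [tag e' == _]eq_sym; case: eqP => //= _; apply: leq_total.
Qed.

(** The ordered edge set whose edges with range [t] are the letters of [w t]. *)
Definition wedge : edge_set S T :=
  @EdgeSet S T wedge_edge wedge_src tag wedge_le wedge_le_refl wedge_le_anti
    wedge_le_trans wedge_le_comparable.

Lemma word_wedge t : word wedge t = w t.
Proof.
rewrite /word (@fiberP _ _ wedge t
  [seq Tagged (fun t => 'I_(size (w t))) i | i <- enum 'I_(size (w t))]).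
- rewrite -map_comp -[RHS](map_tnth_enum (in_tuple (w t))).
  by apply: eq_map => i.
- rewrite sorted_map (eq_sorted (e' := relpre val leq)).
    by rewrite -sorted_map val_enum_ord iota_sorted.
  by move=> i j; rewrite /= /wedge_le /= eqxx.
- rewrite map_inj_uniq ?enum_uniq // => i j /eqP.
  by rewrite eq_Tagged => /eqP.
- move=> [t' i] /=; apply/mapP/eqP => [[j _ /(congr1 tag)] //|tt].
  by case: _ / tt i => i; exists i; rewrite ?mem_enum.
Qed.

End WordEdges.

Section WordTheory.
Variables S T : finType.
Implicit Types F G : edge_set S T.

Lemma edge_iso_wedge F : F ≅ wedge (word F).
Proof.
have idx (e : F) : (index e (fiber F (rng e)) < size (word F (rng e)))%N.
  by rewrite size_map index_mem mem_fiber.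
pose h e : wedge (word F) := Tagged _ (Ordinal (idx e)).
have h_inj : injective h.
  move=> e e' hh; have rr : rng e = rng e' by apply: (congr1 tag hh).
  have ii : index e (fiber F (rng e)) = index e' (fiber F (rng e')).
    by apply: (congr1 (fun p : wedge (word F) => nat_of_ord (tagged p)) hh).
  have := @nth_index _ e e (fiber F (rng e)); rewrite mem_fiber eqxx ii rr => <- //.
  by rewrite nth_index // mem_fiber.
exists h; split=> //.
- have h_surj p : exists e, h e = p.
    case: p => t [i it].
    have it' : (i < size (fiber F t))%N by move: (it); rewrite size_map.
    have [e eE] : exists e, onth (fiber F t) i = Some e.
      by have := onthTE (fiber F t) i; rewrite it'; case: onth => // e; exists e.
    have ie : index e (fiber F t) = i.
      by rewrite -(onth_nth e _ _ _ eE) index_uniq ?fiber_uniq.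
    have /eqP et : rng e == t by rewrite -mem_fiber; apply/onthP; exists i.
    exists e; rewrite /h; move: (idx e); rewrite et => idx'.
    by congr existT; apply: val_inj.
  have [g gK] := choice h_surj; exists g => // e.
  by apply: h_inj; rewrite gK.
- move=> e; rewrite [LHS](tnth_nth (src e)) /= /word (nth_map e).
    by rewrite nth_index ?mem_fiber.
  by rewrite index_mem mem_fiber.
- move=> e e'; rewrite [RHS]edge_le_index.
  transitivity ((rng e == rng e') &&
    (index e (fiber F (rng e)) <= index e' (fiber F (rng e')))%N); first by [].
  by case: eqP => [->|].
Qed.

(** An ordered edge set is determined, up to isomorphism, by its words. *)
Lemma edge_isoP F G : F ≅ G <-> word F =1 word G.
Proof.
split=> [[h [hb hs hr hl]] t|/funext FG]; last first.
  by rewrite (edge_iso_wedge F) FG -edge_iso_wedge; reflexivity.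
rewrite /word (@fiberP _ _ G t (map h (fiber F t))).
- by rewrite -map_comp; apply: eq_map => e /=.
- by rewrite sorted_map (eq_sorted hl) fiber_sorted.
- by rewrite (map_inj_uniq (bij_inj hb)) fiber_uniq.
- case: hb => k hK kK e; rewrite -[e]kK (mem_map (can_inj hK)) mem_fiber.
  by rewrite hr.
Qed.

Lemma word_rng F t : (exists e : F, rng e = t) <-> word F t <> [::].
Proof.
split=> [[e et] /(congr1 size)|]; rewrite ?size_map.
  have : e \in fiber F t by rewrite mem_fiber et.
  by case: (fiber F t).
rewrite /word; case E: (fiber F t) => [|e s] // _; exists e; apply/eqP.
by rewrite -mem_fiber E inE eqxx.
Qed.

Lemma word_src F s : (exists e : F, src e = s) <-> exists t, s \in word F t.
Proof.
split=> [[e es]|[t /mapP[e _ ->]]]; last by exists e.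
by exists (rng e); apply/mapP; exists e; rewrite ?mem_fiber.
Qed.

Lemma word_span F s t :
  (exists e : F, src e = s /\ rng e = t) <-> s \in word F t.
Proof.
split=> [[e [es et]]|/mapP[e]]; first by apply/mapP; exists e; rewrite // mem_fiber et.
by rewrite mem_fiber => /eqP et ->; exists e.
Qed.

End WordTheory.

(** Composition of edge sets is substitution of words. *)
Lemma word_ecomp (S T U : finType) (F : edge_set S T) (G : edge_set T U) u :
  word (F ∘ G) u = flatten [seq word F t | t <- word G u].
Proof.
pose le (p q : F * G) := (p.2 != q.2) && edge_le p.2 q.2
  || (p.2 == q.2) && edge_le p.1 q.1.
have le_anti : antisymmetric le.
  move=> [e g] [e' g'] /andP[]; rewrite /le /= (eq_sym g' g).
  case: eqVneq => [<- /= h1 h2|/eqP ng /=].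
    by congr (_, _); apply: edge_le_anti; rewrite h1 h2.
  by rewrite !orbF => h1 h2; case: ng; apply: edge_le_anti; rewrite h1 h2.
have fP (V W : finType) (K : edge_set V W) w : pairwise (@edge_le _ _ K) (fiber K w).
  by rewrite -sorted_pairwise ?fiber_sorted //; exact: edge_le_trans.
have fE : map sval (fiber (F ∘ G) u) =
    [seq (e, g) | g <- fiber G u, e <- fiber F (src g)].
  apply: (pairwise_eq le_anti); first by rewrite pairwise_map; apply: fP.
    elim: (fiber G u) (fP _ _ G u) (fiber_uniq G u) => //= g s IH.
    move=> /andP[gs ss] /andP[gNs us]; rewrite pairwise_cat IH // andbT.
    apply/andP; split.
      apply/allrelP => _ _ /mapP[e _ ->] /allpairsPdep[g' [e' [g's _ ->]]].
      rewrite /le /=; have -> : g != g' by apply: contraNneq gNs => ->.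
      by rewrite (allP gs).
    rewrite pairwise_map; apply: sub_pairwise (fP _ _ F (src g)) => e e' ee'.
    by rewrite /= /le /= eqxx /= ee'.
  apply: uniq_perm.
  - have sI : injective (fun p : F ∘ G => sval p).
      by move=> p q pq; exact: (@val_inj _ _ (ecomp_edge F G)).
    by rewrite (map_inj_uniq sI) fiber_uniq.
  - apply: allpairs_uniq_dep; first exact: fiber_uniq.
      by move=> g _; exact: fiber_uniq.
    by move=> [g e] [g' e'] _ _ /= [-> ->].
  - move=> [e g]; apply/mapP/allpairsPdep.
      move=> [[[e' g'] eg]]; rewrite (@mem_fiber _ _ (F ∘ G)) /= => rg [-> ->].
      by exists g', e'; rewrite !mem_fiber.
    move=> [g' [e' []]]; rewrite !mem_fiber => rg re [-> ->].
    by exists (epair re); rewrite ?(@mem_fiber _ _ (F ∘ G)).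
transitivity [seq src p.1 | p <- map sval (fiber (F ∘ G) u)].
  by rewrite -map_comp.
rewrite fE map_allpairs /word; congr flatten; rewrite -map_comp.
by apply: eq_map => g.
Qed.

Lemma word_ediag (V : nat -> finType) k v : word (ediag V k k) v = [:: v].
Proof.
have P : existT (fun n => V n : Type) k v == existT _ k v by [].
rewrite /word (@fiberP _ _ _ _ [:: (exist _ (v, v) P : ediag V k k)]) //.
move=> [[a b] ab]; rewrite inE -val_eqE /= xpair_eqE.
suff -> : a = b by rewrite andbb.
move: ab => /= /eqP ab; apply: (@eq_from_Tagged _ (fun n => V n : Type) k).
by rewrite /Tagged ab.
Qed.


(** * Locating a floor in a coarser family of towers *)

Section Pull.
Variables (S T : finType).
Implicit Types (F : edge_set S T) (hS : S -> nat) (hT : T -> nat).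

(** The towers of heights [hT] are obtained by stacking towers of heights [hS]
    as prescribed by the words of [F]. *)
Definition stacked F hS hT : Prop := forall t, hT t = size (expand hS (word F t)).

(** The floor of the small towers in which the floor [c] of the large ones
    lies. *)
Definition pull F hS (c : T * nat) : option (S * nat) :=
  onth (expand hS (word F c.1)) c.2.

Variables (F : edge_set S T) (hS : S -> nat) (hT : T -> nat).

Lemma pull_some c : stacked F hS hT -> (c.2 < hT c.1)%N ->
  exists2 d, pull F hS c = Some d & (d.2 < hS d.1)%N.
Proof.
move=> st clt; have := onthTE (expand hS (word F c.1)) c.2.
rewrite -st clt; case E: onth => [d|] // _; exists d => //.
exact: expand_lt E.
Qed.

(** The edge of [F] through which [c] is located. *)
Lemma pull_edge c d : pull F hS c = Some d -> exists e : F,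
  [/\ onth (expand (hS \o @src _ _ F) (fiber F c.1)) c.2 = Some (e, d.2),
      src e = d.1 & rng e = c.1].
Proof.
rewrite /pull /word expand_map onth_map; case E: (onth _ _) => [[e i]|] //= [<-].
exists e; split=> //; apply/eqP; rewrite -mem_fiber.
exact: (expand_mem E).
Qed.

Hypothesis hS0 : forall s, (0 < hS s)%N.

Lemma pull_bottom c d : pull F hS c = Some d -> c.2 = 0%N -> d.2 = 0%N.
Proof. by rewrite /pull => + c0; rewrite c0; apply: expand_bottom. Qed.

Lemma pull_top c d : stacked F hS hT ->
  pull F hS c = Some d -> c.2.+1 = hT c.1 -> d.2.+1 = hS d.1.
Proof. by move=> st pc; rewrite st => ct; apply: expand_top ct pc. Qed.

Lemma pull_top_last c d s : stacked F hS hT ->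
  pull F hS c = Some d -> c.2.+1 = hT c.1 -> d.1 = last s (word F c.1).
Proof. by move=> st pc; rewrite st => ct; apply: expand_last ct pc. Qed.

Lemma pull_bottom_head c d s :
  pull F hS c = Some d -> c.2 = 0%N -> d.1 = head s (word F c.1).
Proof. by rewrite /pull => + c0; rewrite c0; apply: expand_head. Qed.

Lemma pull_step c c' d d' : stacked F hS hT -> step hT c c' ->
  pull F hS c = Some d -> pull F hS c' = Some d' -> step hS d d'.
Proof.
move=> st [[_ ->]|[ct c'0]]; first exact: expand_step.
by move=> /(pull_top st) dt /pull_bottom d'0; right; rewrite dt // d'0.
Qed.

Lemma pull_inj (F' : edge_set S T) : stacked F hS hT -> stacked F' hS hT ->
  (forall c, (c.2 < hT c.1)%N -> pull F hS c = pull F' hS c) -> F ≅ F'.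
Proof.
move=> st st' FF; apply/edge_isoP => t; apply: (expand_inj hS0).
apply: eq_from_onth => j; case: (ltnP j (hT t)) => jt; first exact: (FF (t, j)).
by rewrite !onth_default // -?st -?st'.
Qed.

End Pull.

Section PullTheory.
Variables (S T U : finType).

Lemma pull_iso (F F' : edge_set S T) hS c : F ≅ F' -> pull F hS c = pull F' hS c.
Proof. by move=> /edge_isoP FF; rewrite /pull FF. Qed.

Variables (F : edge_set S T) (G : edge_set T U).
Variables (hS : S -> nat) (hT : T -> nat) (hU : U -> nat).

Lemma pull_ecomp c : stacked F hS hT ->
  pull (F ∘ G) hS c = obind (pull F hS) (pull G hT c).
Proof. by move=> st; rewrite /pull word_ecomp (onth_expand_flatten _ _ st). Qed.

Lemma stacked_ecomp : stacked F hS hT -> stacked G hT hU -> stacked (F ∘ G) hS hU.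
Proof. by move=> st st' u; rewrite word_ecomp (size_expand_flatten _ st) -st'. Qed.

End PullTheory.

Lemma stacked_ediag (V : nat -> finType) k h : stacked (ediag V k k) h h.
Proof. by move=> v; rewrite word_ediag size_expand_cons addn0. Qed.

Lemma pull_ediag (V : nat -> finType) k h c : (c.2 < h c.1)%N ->
  pull (ediag V k k) h c = Some c.
Proof.
by move=> clt; rewrite /pull word_ediag onth_expand_cons clt -surjective_pairing.
Qed.

(** [F] describes [a], with respect to the locations [l] and [l'] in families
    of towers: the words of [F] tell how the towers of [Y] are sent over the
    towers of [X]. *)
Definition describes (X Y : Type) (S T : finType) (F : edge_set S T)
    (hS : S -> nat) (hT : T -> nat) (l : X -> S * nat) (l' : Y -> T * nat)
    (a : Y -> X) : Prop :=
  stacked F hS hT /\ forall y, pull F hS (l' y) = Some (l (a y)).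

Lemma describes_ecomp (X Y Z : Type) (S T U : finType) (F : edge_set S T)
    (G : edge_set T U) hS hT hU (l : X -> S * nat) (l' : Y -> T * nat)
    (l'' : Z -> U * nat) a b :
  describes F hS hT l l' a -> describes G hT hU l' l'' b ->
  describes (F ∘ G) hS hU l l'' (a \o b).
Proof.
move=> [st1 pF] [st2 pG]; split; first exact: stacked_ecomp st1 st2.
by move=> z; rewrite (pull_ecomp _ _ st1) pG /= pF.
Qed.

(** At most one edge set, up to isomorphism, describes a given map. *)
Lemma describes_inj (X Y : Type) (S T : finType) (F F' : edge_set S T) hS hT
    (l : X -> S * nat) (l' : Y -> T * nat) a :
  (forall s, 0 < hS s)%N ->
  (forall t j, (j < hT t)%N -> exists y, l' y = (t, j)) ->
  describes F hS hT l l' a -> describes F' hS hT l l' a -> F ≅ F'.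
Proof.
move=> hS0 l's [st pF] [st' pF']; apply: (pull_inj hS0 st st') => -[t j] tj.
by have [y <-] := l's _ _ tj; rewrite pF pF'.
Qed.

(** A map [a] intertwining two dynamics is described by some edge set as soon
    as the floor of [a y] depends only on the floor of [y] and [a] sends top
    floors to top floors. *)
Lemma describes_exists (X Y : Type) (phi : X -> X) (psi : Y -> Y)
    (S T : finType) (hS : S -> nat) (hT : T -> nat)
    (l : X -> S * nat) (l' : Y -> T * nat) (a : Y -> X) :
  (forall s, 0 < hS s)%N -> (forall t, 0 < hT t)%N ->
  (forall x, (l x).2 < hS (l x).1)%N ->
  (forall x, step hS (l x) (l (phi x))) ->
  (forall y, step hT (l' y) (l' (psi y))) ->
  (forall t j, (j < hT t)%N -> exists y, l' y = (t, j)) ->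
  (forall y, exists y', psi y' = y) ->
  (forall y, a (psi y) = phi (a y)) ->
  (forall y y', l' y = l' y' -> l (a y) = l (a y')) ->
  (forall y, (l' y).2.+1 = hT (l' y).1 -> (l (a y)).2.+1 = hS (l (a y)).1) ->
  exists F : edge_set S T, describes F hS hT l l' a.
Proof.
move=> hS0 hT0 llt lS l'S l's psis aE lf lt.
have iterE t y j : l' y = (t, 0%N) -> (j < hT t)%N -> l' (iter j psi y) = (t, j).
  move=> yt; elim: j => // j IH jt; have {}IH := IH (ltnW jt).
  have [[_]|[]] := l'S (iter j psi y); rewrite IH // => jt'.
  by rewrite -jt' ltnn in jt.
have bot y : (l' y).2 = 0%N -> (l (a y)).2 = 0%N.
  have [y' <-] := psis y => y0.
  have [[_ yE]|[/lt y't _]] := l'S y'; first by rewrite yE in y0.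
  by rewrite aE; have [[]|[]] := lS (a y'); rewrite y't // ltnn.
have ex t : exists w, hT t = size (expand hS w) /\
    forall y, (l' y).1 = t -> onth (expand hS w) (l' y).2 = Some (l (a y)).
  have [y0 y0t] := l's t 0%N (hT0 t).
  pose f j := l (a (iter j psi y0)).
  have fE : [seq f i | i <- iota 0 (hT t)] =
      expand hS [seq c.1 | c <- [seq f i | i <- iota 0 (hT t)] & c.2 == 0].
    apply: step_expand => //; first by move=> i _; rewrite /f iterS aE; exact: lS.
      by apply: bot; rewrite y0t.
    by apply: lt; rewrite (iterE t) // prednK.
  exists [seq c.1 | c <- [seq f i | i <- iota 0 (hT t)] & c.2 == 0].
  rewrite -fE size_map size_iota; split=> // y yt.
  have [j jt yj] : exists2 j, (j < hT t)%N & l' y = (t, j).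
    exists (l' y).2; last by rewrite -yt -surjective_pairing.
    have [[y1 _]|[y1 _]] := l'S y; rewrite -yt; first exact: ltnW.
    by rewrite -y1.
  rewrite yj onth_map.
  have := odflt_onth 0 (iota 0 (hT t)) j; have := onthTE (iota 0 (hT t)) j.
  rewrite size_iota jt nth_iota //; case: onth => //= i _ ->.
  by congr Some; apply: lf; rewrite yj (iterE t).
have [w wP] := choice ex; exists (wedge w); split=> [t|y].
  by rewrite word_wedge; have [] := wP t.
by rewrite /pull word_wedge; have [_] := wP (l' y).1; apply.
Qed.

(** * Labellings by the towers of a Bratteli diagram *)

(** Every point of [T] is located, at each level [n], on a floor of a tower
    indexed by a vertex of level [n]; [hgt n v] is the height of the tower [v].
    The towers of level [n + 1] are stacked from those of level [n] according
    to the edges of the diagram. *)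
Record labelling (T : Type) (B : ordered_bratteli) := Labelling {
  hgt : forall n, vert B n -> nat;
  lab : forall n, T -> vert B n * nat;
  hgt_gt0 : forall n (v : vert B n), (0 < hgt v)%N;
  hgt0 : forall v : vert B 0, hgt v = 1%N;
  lab_lt : forall n x, ((lab n x).2 < hgt (lab n x).1)%N;
  lab_surj : forall n (v : vert B n) j, (j < hgt v)%N ->
    exists x, lab n x = (v, j);
  lab_inj : forall x y, (forall n, lab n x = lab n y) -> x = y;
  lab_edges : forall n, describes (edges B n) (@hgt n) (@hgt n.+1)
    (lab n) (lab n.+1) id }.

Arguments hgt {T B} _ n _.
Arguments lab {T B} _ n _.
Arguments hgt_gt0 {T B} _ {n} v.

Section Labelling.
Variables (T : Type) (B : ordered_bratteli) (L : labelling T B).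
Implicit Types x y : T.

(** [x] lies on the top, resp. bottom, floor of its tower of level [n]. *)
Definition at_top n x : Prop := (lab L n x).2.+1 = hgt L n (lab L n x).1.
Definition at_bottom n x : Prop := (lab L n x).2 = 0%N.

Lemma lab_span n m : (n <= m)%N ->
  describes (espan B n m) (hgt L n) (hgt L m) (lab L n) (lab L m) id.
Proof.
elim: m => [|m IH]; last rewrite leq_eqVlt => /orP[/eqP<-|]; last first.
- by rewrite ltnS => nm; rewrite espanS //; apply: describes_ecomp (IH nm) (lab_edges L m).
- rewrite espan_diag; split; first exact: stacked_ediag.
  by move=> x; rewrite pull_ediag // lab_lt.
- rewrite leqn0 => /eqP ->; rewrite espan_diag; split; first exact: stacked_ediag.
  by move=> x; rewrite pull_ediag // lab_lt.
Qed.

Lemma lab_le n m x y : (n <= m)%N -> lab L m x = lab L m y -> lab L n x = lab L n y.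
Proof.
by move=> /lab_span[_ p] xy; have := p x; rewrite xy p => -[].
Qed.

Lemma step_le n m x y : (n <= m)%N ->
  step (hgt L m) (lab L m x) (lab L m y) -> step (hgt L n) (lab L n x) (lab L n y).
Proof.
move=> /lab_span[st p] xy.
by have := pull_step (hgt_gt0 L (n := n)) st xy (p x) (p y).
Qed.

Lemma top_le n m x : (n <= m)%N -> at_top m x -> at_top n x.
Proof.
by move=> /lab_span[st p]; exact: (pull_top (hgt_gt0 L (n := n)) st (p x)).
Qed.

Lemma bottom_le n m x : (n <= m)%N -> at_bottom m x -> at_bottom n x.
Proof.
by move=> /lab_span[_ p]; exact: (pull_bottom (hgt_gt0 L (n := n)) (p x)).
Qed.

Lemma top0 x : at_top 0 x.
Proof.
by rewrite /at_top; have := lab_lt L 0 x; rewrite hgt0 ltnS leqn0 => /eqP ->.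
Qed.

Lemma lab0 x y : lab L 0 x = lab L 0 y.
Proof.
have b z : (lab L 0 z).2 = 0%N.
  by have := lab_lt L 0 z; rewrite hgt0 ltnS leqn0 => /eqP.
have /card_le1_eqP V1 : (#|vert B 0| <= 1)%N by rewrite vert0.
rewrite [LHS]surjective_pairing [RHS]surjective_pairing !b.
by congr (_, _); exact: V1.
Qed.

(** A point that is not on a top floor has only one possible successor; the
    case of a point lying on a top floor at every level is settled by
    hypothesis. *)
Lemma step_fun x y y' :
  (forall z z', (forall n, at_bottom n z) -> (forall n, at_bottom n z') -> z = z') ->
  (forall n, step (hgt L n) (lab L n x) (lab L n y)) ->
  (forall n, step (hgt L n) (lab L n x) (lab L n y')) -> y = y'.
Proof.
move=> bot xy xy'; have [xt|/existsNP[n0 xt]] := pselect (forall n, at_top n x).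
  by apply: bot => n; [have [[]|[]] := xy n|have [[]|[]] := xy' n]; rewrite ?xt ?ltnn.
apply: lab_inj => n; apply: (lab_le (leq_maxl n n0)).
have xt' : ~ at_top (maxn n n0) x by apply: contra_not xt; exact/top_le/leq_maxr.
have [[_ ->]|[]] := xy (maxn n n0); last by move=> /xt'.
by have [[_ ->]|[]] := xy' (maxn n n0); last by move=> /xt'.
Qed.

Lemma step_cofun x x' y :
  (forall z z', (forall n, at_top n z) -> (forall n, at_top n z') -> z = z') ->
  (forall n, step (hgt L n) (lab L n x) (lab L n y)) ->
  (forall n, step (hgt L n) (lab L n x') (lab L n y)) -> x = x'.
Proof.
move=> top xy xy'; have [yb|/existsNP[n0 yb]] := pselect (forall n, at_bottom n y).
  apply: top => n; [have [[_ E]|[]] := xy n|have [[_ E]|[]] := xy' n] => //.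
    by have := yb n; rewrite /at_bottom E.
  by have := yb n; rewrite /at_bottom E.
apply: lab_inj => n; apply: (lab_le (leq_maxl n n0)).
have yb' : ~ at_bottom (maxn n n0) y.
  by apply: contra_not yb; exact/bottom_le/leq_maxr.
have [[_ E]|[]] := xy (maxn n n0); last by move=> _ /yb'.
have [[_]|[]] := xy' (maxn n n0); last by move=> _ /yb'.
rewrite E => -[E1 E2].
by rewrite [LHS]surjective_pairing [RHS]surjective_pairing E1 E2.
Qed.

(** Every coherent sequence of floors is the sequence of floors of a point. *)
Definition complete : Prop := forall c : forall n, vert B n * nat,
  (forall n, (c n).2 < hgt L n (c n).1)%N ->
  (forall n, pull (edges B n) (hgt L n) (c n.+1) = Some (c n)) ->
  exists x, forall n, lab L n x = c n.

End Labelling.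

(** * Compactness *)

Lemma compact_nested (X : topologicalType) (A : nat -> set X) :
  compact [set: X] -> (forall n, closed (A n)) ->
  (forall n, A n.+1 `<=` A n) -> (forall n, A n !=set0) ->
  exists x, forall n, A n x.
Proof.
move=> cX cA AS A0.
have Ale n m : (n <= m)%N -> A m `<=` A n.
  elim: m => [|m IH]; first by rewrite leqn0 => /eqP ->.
  rewrite leq_eqVlt => /orP[/eqP <- //|]; rewrite ltnS => /IH.
  by apply: subset_trans; exact: AS.
pose F := filter_from [set: nat] A.
have FF : ProperFilter F.
  split; first by case=> n _ An; have [x /An] := A0 n.
  apply: filter_from_filter; first by exists 0%N.
  move=> i j _ _; exists (maxn i j) => //; rewrite subsetI.
  by split; apply: Ale; rewrite ?leq_maxl ?leq_maxr.
have [|x [_ Fx]] := cX F FF; first exact: filterT.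
exists x => n; move: Fx; rewrite clusterE => /(_ (A n)) /=.
by rewrite -(closure_id (A n)).1 //; apply; exists n.
Qed.

Section CompactLabelling.
Variables (X : topologicalType) (B : ordered_bratteli) (L : labelling X B).
Hypothesis compactX : compact [set: X].
Hypothesis lab_open : forall n c, open [set x | lab L n x = c].

Lemma open_lab n (P : vert B n * nat -> Prop) : open [set x | P (lab L n x)].
Proof.
have -> : [set x | P (lab L n x)] = \bigcup_(c in [set c | P c]) [set x | lab L n x = c].
  apply/seteqP; split=> [x Px|x [c Pc xc]]; first by exists (lab L n x).
  by move: Pc; rewrite /= -xc.
by apply: bigcup_open => c _; exact: lab_open.
Qed.

Lemma closed_lab n (P : vert B n * nat -> Prop) : closed [set x | P (lab L n x)].
Proof.
rewrite -[[set x | _]]setCK; apply: open_closedC.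
exact: (@open_lab n (fun c => ~ P c)).
Qed.

Lemma lab_nbhs n x : nbhs x [set y | lab L n y = lab L n x].
Proof. by apply: open_nbhs_nbhs; split=> //; exact: lab_open. Qed.

Lemma lab_complete : complete L.
Proof.
move=> c clt cS.
have cE n m x : (n <= m)%N -> lab L m x = c m -> lab L n x = c n.
  elim: m => [|m IH]; first by rewrite leqn0 => /eqP ->.
  rewrite leq_eqVlt => /orP[/eqP -> //|]; rewrite ltnS => nm xm.
  apply: IH => //; have [_ p] := lab_edges L m.
  by have := p x; rewrite xm cS => -[].
apply: (@compact_nested _ (fun n => [set x | lab L n x = c n])) => // n.
- exact: (@closed_lab n (fun d => d = c n)).
- by move=> x; exact: cE.
- have [x xc] := lab_surj (clt n).
  by exists x; rewrite /= xc -surjective_pairing.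
Qed.

(** The points with the same floor as [x] at level [n] form a neighbourhood
    basis of [x]. *)
Lemma lab_basis x (U : set X) : open U -> U x ->
  exists n, forall y, lab L n y = lab L n x -> U y.
Proof.
move=> oU Ux; apply: contrapT => /forallNP H.
have [|||y yP] := @compact_nested _
    (fun n => [set y | lab L n y = lab L n x /\ ~ U y]) compactX.
- move=> n; apply: closedI; last exact: open_closedC.
  exact: (@closed_lab n (fun d => d = lab L n x)).
- by move=> n y [yx Uy]; split=> //; exact: lab_le yx.
- by move=> n; apply: contrapT => /forallNP N; apply: (H n) => y yx; apply: contrapT => Uy; exact: (N y).
have [_] := yP 0%N; apply; have -> // : y = x.
by apply: (@lab_inj _ _ L) => n; have [] := yP n.
Qed.

(** If [x0] is the only point satisfying all of the decreasing conditions
    [P n], these conditions determine the floors of [x0]. *)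
Lemma lab_shrink (P : forall n, vert B n * nat -> Prop) x0 :
  (forall n x, P n.+1 (lab L n.+1 x) -> P n (lab L n x)) ->
  (forall x, (forall n, P n (lab L n x)) -> x = x0) ->
  forall n, exists m, forall x, P m (lab L m x) -> lab L n x = lab L n x0.
Proof.
move=> PS Px0 n; apply: contrapT => /forallNP H.
have [|||y yP] := @compact_nested _
    (fun m => [set x | P m (lab L m x) /\ lab L n x <> lab L n x0]) compactX.
- move=> m; apply: closedI; first exact: (@closed_lab m (P m)).
  exact: (@closed_lab n (fun d => d <> lab L n x0)).
- by move=> m x [/PS Pm xn].
- move=> m; apply: contrapT => /forallNP N; apply: (H m) => x xm.
  by apply: contrapT => xn; exact: (N x).
have [_] := yP 0%N; apply; congr (lab L n _).
by apply: Px0 => m; have [] := yP m.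
Qed.

Lemma lab_continuous (Y : topologicalType) (f : Y -> X) :
  (forall n y, \forall z \near y, lab L n (f z) = lab L n (f y)) -> continuous f.
Proof.
move=> fn y U; rewrite nbhsE => -[V [oV Vy] VU].
have [n nV] := lab_basis oV Vy.
by apply: filterS (fn n y) => z /nV /VU.
Qed.

End CompactLabelling.

(** The labelling is compatible with the dynamics: the map climbs the towers,
    and [x0] is the only point that lies on a top floor at every level. *)
Record model (X : topologicalType) (phi : X -> X) (x0 : X)
    (B : ordered_bratteli) := Model {
  mlab :> labelling X B;
  mlab_open : forall n c, open [set x | lab mlab n x = c];
  mlab_step : forall n x, step (hgt mlab n) (lab mlab n x) (lab mlab n (phi x));
  mlab_top : forall n, at_top mlab n x0;
  mlab_top_uniq : forall x, (forall n, at_top mlab n x) -> x = x0 }.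

Arguments mlab_open {X phi x0 B} m n c.
Arguments mlab_step {X phi x0 B} m n x.
Arguments mlab_top {X phi x0 B} m n.
Arguments mlab_top_uniq {X phi x0 B} m x _.


(** * Premorphisms and equivariant maps *)

(** [f] induces [a] when the edges of [f] describe [a] at every level. *)
Definition induces (X Y : Type) (B C : ordered_bratteli) (M : labelling X B)
    (N : labelling Y C) (f : premorphism B C) (a : Y -> X) : Prop :=
  forall n, describes (pedge f n) (hgt M n) (hgt N (plevel f n))
    (lab M n) (lab N (plevel f n)) a.

Section Induces.
Variables (X Y : Type) (B C : ordered_bratteli).
Variables (M : labelling X B) (N : labelling Y C).
Implicit Types f g : premorphism B C.

(** The heights of the towers are compatible with [f]: both sides of the
    commutation relation count the floors of level [n] in a tower of [C]. *)
Lemma stacked_pedge f n : stacked (pedge f n) (hgt M n) (hgt N (plevel f n)).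
Proof.
elim: n => [w|n IH w].
  have -> : hgt N (plevel f 0) w = 1%N.
    by move: w; rewrite (plevel0 f) => w; exact: hgt0.
  have [e ew] := pedge_rng w.
  have /card_le1_eqP E1 : (#|pedge f 0| <= 1)%N by rewrite pedge0.
  rewrite /word (@fiberP _ _ _ _ [:: e]) //.
    by rewrite size_expand_cons hgt0.
  move=> e'; rewrite inE; have -> : e' = e by exact: E1.
  by rewrite ew !eqxx.
have [stC _] := lab_span N (plevel_le f n).
have [stB _] := lab_edges M n.
rewrite stC -(size_expand_flatten _ IH) -word_ecomp.
have /edge_isoP <- := pedge_commute f n.
by rewrite word_ecomp (size_expand_flatten _ stB).
Qed.

Lemma describes_span_pedge f n m a : induces M N f a -> (n <= m)%N ->
  describes (espan B n m ∘ pedge f m) (hgt M n) (hgt N (plevel f m))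
    (lab M n) (lab N (plevel f m)) a.
Proof. by move=> fa nm; exact: describes_ecomp (lab_span M nm) (fa m). Qed.

Lemma describes_pedge_span f n m a : induces M N f a -> (plevel f n <= m)%N ->
  describes (pedge f n ∘ espan C (plevel f n) m) (hgt M n) (hgt N m)
    (lab M n) (lab N m) a.
Proof. by move=> fa nm; exact: describes_ecomp (fa n) (lab_span N nm). Qed.

Lemma induces_pequiv_at f g a n : induces M N f a -> induces M N g a ->
  exists m, pequiv_at f g n m.
Proof.
move=> fa ga; have [m fm] := plevel_unbounded g (plevel f n).
have fg : (plevel f n <= plevel g (maxn n m))%N.
  by apply: leq_trans (ltnW fm) (plevel_mono g (leq_maxr n m)).
exists (maxn n m); split; rewrite ?leq_maxl //.
apply: (describes_inj (hgt_gt0 M (n := n)) _ (describes_span_pedge ga (leq_maxl n m))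
  (describes_pedge_span fa fg)).
by move=> t j; exact: lab_surj.
Qed.

(** All the premorphisms inducing a given map are equivalent. *)
Lemma induces_pequiv f g a : induces M N f a -> induces M N g a -> pequiv f g.
Proof.
by move=> fa ga; apply/pequivP; split=> n; exact: (@induces_pequiv_at _ _ a).
Qed.

(** Equivalent premorphisms induce at most one map. *)
Lemma pequiv_induces f g a b :
  induces M N f a -> induces M N g b -> pequiv f g -> a = b.
Proof.
move=> fa gb /pequivP[fg _]; apply/funext => y; apply: (lab_inj (l := M)) => n.
have [m [nm fgm i]] := fg n.
have [_ p] := describes_pedge_span fa fgm.
have [_ q] := describes_span_pedge gb nm.
by have := p y; rewrite -(pull_iso _ _ i) q => -[].
Qed.

End Induces.

Lemma induces_pid (X : Type) (B : ordered_bratteli) (M : labelling X B) :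
  induces M M (pid B) id.
Proof. by move=> n; exact: (lab_span M (leqnn n)). Qed.

Lemma induces_pcomp (X Y Z : Type) (B C D : ordered_bratteli)
    (M : labelling X B) (N : labelling Y C) (P : labelling Z D)
    (f : premorphism B C) (g : premorphism C D) a b :
  induces M N f a -> induces N P g b -> induces M P (Defs.pcomp g f) (a \o b).
Proof. by move=> fa gb n; exact: describes_ecomp (fa n) (gb _). Qed.

Section Homs.
Variables (X Y : topologicalType) (phi : X -> X) (psi : Y -> Y) (x0 : X) (y0 : Y).
Variables (B C : ordered_bratteli) (M : model phi x0 B) (N : model psi y0 C).
Hypotheses (compactX : compact [set: X]) (compactY : compact [set: Y]).
Hypotheses (phi_surj : forall x, exists x', phi x' = x).
Hypotheses (psi_surj : forall y, exists y', psi y' = y).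

Lemma bottom_image x : (forall n, at_bottom M n x) -> x = phi x0.
Proof.
have [x' <-] := phi_surj x => xb; congr (phi _). apply: (mlab_top_uniq M) => n.
have [[_ E]|[]] // := mlab_step M n x'.
by have := xb n; rewrite /at_bottom E.
Qed.

(** The point [a y] is determined by its floors, which are those obtained from
    the floors of [y] through [f]. *)
Lemma premorphism_map (f : premorphism B C) : exists a : Y -> X,
  [/\ continuous a, forall y, a (psi y) = phi (a y), a y0 = x0
    & induces M N f a].
Proof.
have st := @stacked_pedge _ _ _ _ M N f.
have /choice[a aP] : forall y, exists x, forall n,
    pull (pedge f n) (hgt M n) (lab N (plevel f n) y) = Some (lab M n x).
  move=> y.
  have /dep_choice[c cP] : forall n, exists d : vert B n * nat,
      pull (pedge f n) (hgt M n) (lab N (plevel f n) y) = Some d /\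
      (d.2 < hgt M n d.1)%N.
    by move=> n; have [d ? ?] := pull_some (st n) (lab_lt N _ y); exists d.
  have [n|n|x xc] := lab_complete compactX (mlab_open M) (c := c).
  - by have [] := cP n.
  - have [stB _] := lab_edges M n; have [_ p] := lab_span N (plevel_le f n).
    have := pull_ecomp (pedge f n.+1) (lab N (plevel f n.+1) y) stB.
    rewrite (cP n.+1).1 /= => <-; rewrite (pull_iso _ _ (pedge_commute f n)).
    by rewrite (pull_ecomp _ _ (st n)) p /=; have [] := cP n.
  - by exists x => n; rewrite xc; have [] := cP n.
exists a; split; last by move=> n; split; [exact: st|move=> y; exact: aP].
- apply: (lab_continuous compactX (mlab_open M)) => n y.
  apply: filterS (lab_nbhs (mlab_open N) (plevel f n) y) => z /= zy.
  by have := aP z n; rewrite zy aP => -[].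
- move=> y; apply: (@step_fun _ _ M (a y)).
  + by move=> z z' /bottom_image -> /bottom_image.
  + move=> n; apply: (pull_step (hgt_gt0 M (n := n)) (st n) _ (aP y n) (aP _ n)).
    exact: mlab_step.
  + by move=> n; exact: mlab_step.
- apply: (mlab_top_uniq M) => n.
  exact: (pull_top (hgt_gt0 M (n := n)) (st n) (aP y0 n) (mlab_top N _)).
Qed.

Variable a : Y -> X.
Hypotheses (a_cont : continuous a) (a_equiv : forall y, a (psi y) = phi (a y)).
Hypotheses (a_base : a y0 = x0) (a_surj : forall x, exists y, a y = x).

(** The towers of level [m] in [Y] are fine enough to describe [a] in terms of
    those of level [n] in [X]. *)
Let good n m := (forall y y', lab N m y = lab N m y' ->
    lab M n (a y) = lab M n (a y')) /\
  (forall y, at_top N m y -> at_top M n (a y)).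

Let good_le n m m' : (m <= m')%N -> good n m -> good n m'.
Proof.
move=> mm' [g1 g2]; split; first by move=> y y' yy; apply: g1; exact: lab_le yy.
by move=> y yt; apply: g2; exact: top_le yt.
Qed.

Let good0 : good 0 0.
Proof. by split=> [y y' _|y _]; [exact: lab0|exact: top0]. Qed.

Let good_exists n : exists m, good n m.
Proof.
have [m1 m1P] : exists m, forall y y', lab N m y = lab N m y' ->
    lab M n (a y) = lab M n (a y').
  apply: contrapT => /forallNP H.
  pose P m (c : vert C m * nat) := exists y y',
    [/\ lab N m y = c, lab N m y' = c & lab M n (a y) <> lab M n (a y')].
  have [m|m z [y [y' [yz yz' yy]]]|m|z zP] :=
    @compact_nested _ (fun m => [set z | P m (lab N m z)]) compactY.
  - exact: closed_lab (mlab_open N) _ _.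
  - by exists y, y'; split=> //; apply: lab_le (leqnSn m) _.
  - have /existsNP[y /existsNP[y' /not_implyP[yy' ay]]] := H m.
    by exists y, y, y'.
  have [||m mP] := lab_basis compactY (mlab_open N) (x := z)
      (U := [set y | lab M n (a y) = lab M n (a z)]) => //.
    apply: (@open_comp _ _ a [set x | lab M n x = lab M n (a z)]).
      by move=> y _; exact: a_cont.
    exact: mlab_open.
  have [y [y' [yz yz']]] := zP m.
  by apply; rewrite /= (mP _ yz) (mP _ yz').
have [|m2 m2P] := lab_shrink compactY (mlab_open N) (x0 := y0)
    (P := fun m c => c.2.+1 = hgt N m c.1) _ (mlab_top_uniq N) m1.
  by move=> m y; exact: (top_le (leqnSn m)).
exists (maxn m1 m2); split.
  by move=> y y' yy; apply: m1P; exact: lab_le (leq_maxl _ _) yy.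
move=> y /(top_le (leq_maxr m1 m2)) /m2P /m1P; rewrite /at_top => ->.
by rewrite a_base; exact: mlab_top.
Qed.

Lemma map_premorphism : exists f : premorphism B C, induces M N f a.
Proof.
have [m mP] := choice good_exists.
(* Levels are chosen increasing, with [lv 0 = 0] by computation. *)
pose lv := fix lv n := if n is n'.+1 then maxn (lv n').+1 (m n'.+1) else 0%N.
have lvS n : (lv n < lv n.+1)%N by rewrite /= leq_maxl.
have lv_ge n : (n <= lv n)%N by elim: n => // n IH; exact: leq_ltn_trans IH (lvS n).
have lvP n : good n (lv n).
  by case: n => [|n]; [exact: good0|apply: good_le (mP _); rewrite /= leq_maxr].
have /dep_choice[F FP] : forall n, exists F : edge_set (vert B n) (vert C (lv n)),
    describes F (hgt M n) (hgt N (lv n)) (lab M n) (lab N (lv n)) a.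
  move=> n; have [g1 g2] := lvP n.
  apply: (describes_exists (phi := phi) (psi := psi)) g1 g2 => //.
  - exact: hgt_gt0.
  - exact: hgt_gt0.
  - exact: lab_lt.
  - exact: mlab_step.
  - exact: mlab_step.
  - by move=> t j; exact: lab_surj.
have F_src n (v : vert B n) : exists e : F n, src e = v.
  have [x xv] := lab_surj (hgt_gt0 M v); have [y yx] := a_surj x.
  apply/word_src; exists (lab N (lv n) y).1; have [_ p] := FP n.
  by have := expand_mem (p y); rewrite yx xv.
have F_rng n (w : vert C (lv n)) : exists e : F n, rng e = w.
  apply/word_rng => w0; have [st _] := FP n.
  by have := hgt_gt0 N w; rewrite st w0.
have F_neq0 n : (0 < #|F n|)%N.
  have /card_gt0P[v _] := vert_neq0 B n.
  by have [e _] := F_src n v; apply/card_gt0P; exists e.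
have F0 : #|F 0%N| = 1%N.
  apply/eqP; rewrite eqn_leq F_neq0 andbT; apply/card_le1_eqP => e e' _ _.
  have /card_le1_eqP V1 : (#|vert C 0| <= 1)%N by rewrite vert0.
  have [st _] := FP 0%N; have := st (rng e); rewrite hgt0.
  have ee : e' \in fiber (F 0%N) (rng e) by rewrite mem_fiber; apply/eqP; exact: V1.
  have : e \in fiber (F 0%N) (rng e) by rewrite mem_fiber.
  rewrite /word; move: ee; case: (fiber _ _) => [|e1 [|e2 s]] //.
    by rewrite !inE => /eqP -> /eqP ->.
  by rewrite !map_cons !size_expand_cons !hgt0.
have F_com n : edges B n ∘ F n.+1 ≅ F n ∘ espan C (lv n) (lv n.+1).
  apply: (@describes_inj _ _ _ _ _ _ (hgt M n) (hgt N (lv n.+1)) (lab M n)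
    (lab N (lv n.+1)) a); [exact: hgt_gt0|by move=> t j; exact: lab_surj|..].
    exact: describes_ecomp (lab_edges M n) (FP n.+1).
  exact: describes_ecomp (FP n) (lab_span N (ltnW (lvS n))).
have lv_unb K : exists n, (K < lv n)%N by exists K.+1; exact: lv_ge.
by exists (@Premorphism B C lv F erefl (fun n => ltnW (lvS n)) lv_unb F_neq0
  F_src F_rng F0 F_com).
Qed.

End Homs.


(** * The Bratteli diagram of a system of Kakutani-Rokhlin partitions *)

Section KRLabelling.
Variables (X : topologicalType) (phi : X -> X) (x0 : X) (R : kr_system phi x0).

Let floor_exists n x : exists f : {k : 'I_(kr_num (R n)) & 'I_(kr_height (R n) k)},
  kr_set (R n) (tagged f) x.
Proof. by have [k [j jx]] := kr_cover (R n) x; exists (existT _ k j). Qed.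

Let floor n x := sval (cid (floor_exists n x)).

(** The tower and the floor of [x] in the [n]-th partition. *)
Definition kr_lab n x : 'I_(kr_num (R n)) * nat :=
  (tag (floor n x), tagged (floor n x) : nat).

Lemma kr_labP n x k (j : 'I_(kr_height (R n) k)) :
  kr_lab n x = (k, j : nat) <-> kr_set (R n) j x.
Proof.
have fx : kr_set (R n) (tagged (floor n x)) x := svalP (cid (floor_exists n x)).
split=> [|jx].
  rewrite /kr_lab; case: (floor n x) fx => k' j' /= fx [kk].
  by case: _ / kk j => j jj; have <- : j' = j by apply: val_inj.
suff fE : floor n x = existT _ k j by rewrite /kr_lab fE.
by apply: (@kr_disjoint _ _ _ (R n) (floor n x) (existT _ k j) I I); exists x.
Qed.

Lemma kr_lab_lt n x : ((kr_lab n x).2 < kr_height (R n) (kr_lab n x).1)%N.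
Proof. exact: ltn_ord. Qed.

Lemma kr_lab_set n x : kr_set (R n) (Ordinal (kr_lab_lt n x)) x.
Proof. by apply/kr_labP; rewrite -surjective_pairing. Qed.

Lemma kr_lab_surj n k j : (j < kr_height (R n) k)%N ->
  exists x, kr_lab n x = (k, j).
Proof.
by move=> jk; have [x /kr_labP] := kr_neq0 (Ordinal jk); exists x.
Qed.

Lemma kr_lab_open n c : open [set x | kr_lab n x = c].
Proof.
case: c => k j; case: (ltnP j (kr_height (R n) k)) => jk.
  have -> : [set x | kr_lab n x = (k, j)] = kr_set (R n) (Ordinal jk).
    by apply/seteqP; split=> x; rewrite /= -kr_labP.
  by have [] := kr_clopen (Ordinal jk).
have -> : [set x | kr_lab n x = (k, j)] = set0; last exact: open0.
apply/seteqP; split=> x //= xE; have := kr_lab_lt n x.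
by rewrite xE ltnNge jk.
Qed.

Lemma kr_topE n x :
  kr_top (R n) x <-> (kr_lab n x).2.+1 = kr_height (R n) (kr_lab n x).1.
Proof.
split=> [[k [j [jk]]]|xt]; first by rewrite -kr_labP => ->.
by exists (kr_lab n x).1, (Ordinal (kr_lab_lt n x)); split=> //; exact: kr_lab_set.
Qed.

Lemma kr_lab_step n x : step (kr_height (R n)) (kr_lab n x) (kr_lab n (phi x)).
Proof.
have := kr_lab_lt n x; rewrite leq_eqVlt => /orP[/eqP xt|xt].
  right; split=> //; have : kr_bottom (R n) (phi x).
    by rewrite -kr_top_bottom; exists x => //; apply/kr_topE.
  by move=> [k [j [j0]]]; rewrite -kr_labP => ->.
left; split=> //.
have : kr_set (R n) (Ordinal xt) (phi x).
  rewrite -(@kr_next _ _ _ (R n) _ (Ordinal (kr_lab_lt n x)) (Ordinal xt) erefl).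
  by exists x => //; exact: kr_lab_set.
by rewrite -kr_labP.
Qed.

Lemma kr_lab_refine n x y : kr_lab n.+1 x = kr_lab n.+1 y -> kr_lab n x = kr_lab n y.
Proof.
move=> xy; have := kr_lab_set n.+1 x.
set A := kr_set _ _ => Ax.
have Ay : A y by apply/kr_labP; rewrite -xy -surjective_pairing.
have [|A' [k [j A'E]] AA'] := @kr_refine _ _ _ R n A.
  by exists (kr_lab n.+1 x).1, (Ordinal (kr_lab_lt n.+1 x)).
rewrite A'E in AA'.
by have /kr_labP -> := AA' _ Ax; have /kr_labP -> := AA' _ Ay.
Qed.

Lemma kr_set0 k (j : 'I_(kr_height (R 0%N) k)) : kr_set (R 0%N) j = [set: X].
Proof.
have := kr_part0 R; rewrite predeqE => /(_ (kr_set (R 0%N) j)) -[+ _]; apply.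
by exists k, j.
Qed.

Lemma kr_height0 k : kr_height (R 0%N) k = 1%N.
Proof.
have k0 := kr_height_gt0 k; apply/eqP; rewrite eqn_leq k0 andbT leqNgt.
apply/negP => k1.
have /kr_labP : kr_set (R 0%N) (Ordinal k0) x0 by rewrite kr_set0.
have /kr_labP -> : kr_set (R 0%N) (Ordinal k1) x0 by rewrite kr_set0.
by case.
Qed.

Lemma kr_num0 : #|'I_(kr_num (R 0%N))| = 1%N.
Proof.
apply/eqP; rewrite eqn_leq; apply/andP; split; last first.
  by apply/card_gt0P; exists (kr_lab 0 x0).1.
apply/card_le1_eqP => k k' _ _.
have /kr_labP : kr_set (R 0%N) (Ordinal (kr_height_gt0 k)) x0 by rewrite kr_set0.
have /kr_labP -> : kr_set (R 0%N) (Ordinal (kr_height_gt0 k')) x0 by rewrite kr_set0.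
by case.
Qed.

Lemma kr_top_le n x : kr_top (R n.+1) x -> kr_top (R n) x.
Proof.
case: n => [_|n]; last exact: kr_top_decreasing.
by apply/kr_topE; have := kr_lab_lt 0 x; rewrite kr_height0 ltnS leqn0 => /eqP ->.
Qed.

Hypothesis phi_surj : forall x, exists x', phi x' = x.
Hypothesis separated : forall x y, x <> y ->
  exists U : set X, [/\ open U, U x & ~ U y].

Lemma kr_lab_inj x y : (forall n, kr_lab n x = kr_lab n y) -> x = y.
Proof.
move=> xy; apply: contrapT => /separated[U [oU Ux Uy]].
have [_ /(_ x U)] := kr_basis R; case; first by apply: open_nbhs_nbhs.
move=> A [[n _ [k [j ->]]] jx] AU; apply: Uy; apply: AU.
by apply/kr_labP; rewrite -xy; apply/kr_labP.
Qed.

(** The vertices of level [n] are the towers of [R n], and the words of the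
    edges are the itineraries of the towers of [R n.+1] through those of [R n];
    towers of [R n.+1] are stacked from towers of [R n] since the tops decrease
    and the partitions refine each other. *)
Lemma kr_model : exists B, inhabited (model phi x0 B).
Proof.
have /dep_choice[F FP] : forall n,
    exists F : edge_set 'I_(kr_num (R n)) 'I_(kr_num (R n.+1)),
    describes F (kr_height (R n)) (kr_height (R n.+1)) (kr_lab n)
      (kr_lab n.+1) id.
  move=> n; apply: (describes_exists (phi := phi) (psi := phi)) => //.
  - exact: kr_height_gt0.
  - exact: kr_height_gt0.
  - exact: kr_lab_lt.
  - exact: kr_lab_step.
  - exact: kr_lab_step.
  - by move=> k j; exact: kr_lab_surj.
  - exact: kr_lab_refine.
  - by move=> x; rewrite -!kr_topE; exact: kr_top_le.
have F_src n v : exists e : F n, src e = v.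
  have [x xv] := kr_lab_surj (kr_height_gt0 v).
  apply/word_src; exists (kr_lab n.+1 x).1; have [_ p] := FP n.
  by have := expand_mem (p x); rewrite xv.
have F_rng n w : exists e : F n, rng e = w.
  apply/word_rng => w0; have [st _] := FP n.
  by have := kr_height_gt0 w; rewrite st w0.
have V0 n : (0 < #|'I_(kr_num (R n))|)%N.
  by apply/card_gt0P; exists (kr_lab n x0).1.
have F0 n : (0 < #|F n|)%N.
  have /card_gt0P[v _] := V0 n.
  by have [e _] := F_src n v; apply/card_gt0P; exists e.
pose B := @OrderedBratteli (fun n => 'I_(kr_num (R n))) F V0 kr_num0 F0 F_src F_rng.
pose L := @Labelling X B (fun n => kr_height (R n)) kr_lab
  (fun n => @kr_height_gt0 _ _ _ (R n)) kr_height0 kr_lab_lt kr_lab_surj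
  kr_lab_inj FP.
exists B; constructor; apply: (@Model X phi x0 B L).
- exact: kr_lab_open.
- exact: kr_lab_step.
- by move=> n; apply/kr_topE; exact: kr_top_base.
- move=> x xt; have := kr_top_bigcap R; rewrite predeqE => /(_ x) -[+ _]; apply.
  by move=> n _; apply/kr_topE; exact: xt.
Qed.

End KRLabelling.


(** * The diagram of a minimal system *)

Section ModelDiagram.
Variables (X : topologicalType) (phi : X -> X) (x0 : X).
Variables (B : ordered_bratteli) (M : model phi x0 B).
Hypothesis compactX : compact [set: X].

(** Uniqueness of extremal paths: if the conditions [P n] decrease to a single
    point [p], and if an edge that is extremal in the sense of [Q] and ends at
    the tower of [x] of level [n.+1] starts at its tower of level [n] whenever
    the floor of [x] satisfies [P n.+1], then the towers of [p] are the vertices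
    of the only path of extremal edges. *)
Lemma extremal_path_unique (P : forall n, vert B n * nat -> Prop)
    (Q : forall n, edges B n -> Prop) (p : X) :
  (forall n x, P n.+1 (lab M n.+1 x) -> P n (lab M n x)) ->
  (forall n, P n (lab M n p)) ->
  (forall x, (forall n, P n (lab M n x)) -> x = p) ->
  (forall n v, exists x, (lab M n x).1 = v /\ P n (lab M n x)) ->
  (forall n x (e : edges B n), P n.+1 (lab M n.+1 x) ->
    rng e = (lab M n.+1 x).1 -> Q n e -> src e = (lab M n x).1) ->
  (forall n (e : edges B n), exists2 e' : edges B n, rng e' = rng e & Q n e') ->
  (forall n (e e' : edges B n), Q n e -> Q n e' -> rng e = rng e' -> e = e') ->
  exists! e, infinite_paths B e /\ forall n, Q n (e n).
Proof.
move=> PS Pp P_uniq P_ex PQ Q_ex Q_inj.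
have /dep_choice[e eP] : forall n, exists e : edges B n,
    rng e = (lab M n.+1 p).1 /\ Q n e.
  move=> n; have [e ep] := edges_rng (lab M n.+1 p).1.
  by have [e' e'e Qe'] := Q_ex n e; exists e'; rewrite e'e.
exists e; split.
  split=> n; last by have [] := eP n.
  have [en _] := eP n; have [en1 Q1] := eP n.+1.
  by rewrite en (PQ _ _ _ (Pp n.+2) en1 Q1).
move=> y [yp Qy]; apply: functional_extensionality_dep => n.
have [en Qe] := eP n; apply: Q_inj => //; rewrite en.
have Ple k l x : (k <= l)%N -> P l (lab M l x) -> P k (lab M k x).
  elim: l => [|l IH]; first by rewrite leqn0 => /eqP ->.
  by rewrite leq_eqVlt => /orP[/eqP -> //|kl /PS]; exact: IH.
have reach m : exists2 x, P (n + m).+1 (lab M (n + m).+1 x) & (lab M n.+1 x).1 = rng (y n).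
  have [x [xy Px]] := P_ex (n + m).+1 (rng (y (n + m)%N)); exists x => //.
  elim: m x xy Px => [|m IH] x; first by rewrite addn0.
  rewrite addnS => xy Px; apply: IH; last exact: PS.
  by rewrite yp (PQ _ _ _ Px) ?xy.
have [m mP] := lab_shrink compactX (mlab_open M) PS P_uniq n.+1.
have [x Px <-] := reach m; congr (fst _); apply/esym/mP.
by apply: Ple Px; exact: leqW (leq_addl n m).
Qed.

Hypothesis phi_surj : forall x, exists x', phi x' = x.

Lemma model_properly_ordered : properly_ordered B.
Proof.
have h0 n v : (0 < hgt M n v)%N := hgt_gt0 M v.
split.
- apply: (@extremal_path_unique (fun n c => c.2.+1 = hgt M n c.1)
    (fun n e => maximal_edge e) x0).
  + by move=> n x; exact: (top_le (leqnSn n)).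
  + exact: mlab_top.
  + exact: mlab_top_uniq.
  + move=> n v; have [|x xv] := @lab_surj _ _ M n v (hgt M n v).-1.
      by rewrite prednK.
    by exists x; rewrite xv /= prednK.
  + move=> n x e xt ex /maximal_edge_last el; have [st p] := lab_edges M n.
    by rewrite (pull_top_last (h0 n) (src e) st (p x) xt) -ex /word last_map el.
  + by move=> n e; exact: maximal_edge_exists.
  + by move=> n; exact: maximal_edge_inj.
- apply: (@extremal_path_unique (fun n c => c.2 = 0%N)
    (fun n e => minimal_edge e) (phi x0)).
  + by move=> n x; exact: (bottom_le (leqnSn n)).
  + move=> n; have [[]|[]] // := mlab_step M n x0.
    by rewrite (mlab_top M n) ltnn.
  + exact: bottom_image.
  + move=> n v; have [x xv] := @lab_surj _ _ M n v 0%N (h0 n v).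
    by exists x; rewrite xv.
  + move=> n x e xb ex /minimal_edge_head el; have [st p] := lab_edges M n.
    rewrite (pull_bottom_head (h0 n) (src e) (p x) xb) -ex /word.
    by case: (fiber _ _) el => //= a s ->.
  + by move=> n e; exact: minimal_edge_exists.
  + by move=> n; exact: minimal_edge_inj.
Qed.

Lemma model_infinite_paths : infinite_set [set: X] -> infinite_set (infinite_paths B).
Proof.
have /choice[e eP] : forall x, exists e : forall n, edges B n, forall n,
    [/\ onth (expand (hgt M n \o @src _ _ (edges B n))
          (fiber (edges B n) (lab M n.+1 x).1)) (lab M n.+1 x).2 =
          Some (e n, (lab M n x).2),
        src (e n) = (lab M n x).1 & rng (e n) = (lab M n.+1 x).1].
  move=> x; have H n : exists e : edges B n,
    [/\ onth (expand (hgt M n \o @src _ _ (edges B n))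
          (fiber (edges B n) (lab M n.+1 x).1)) (lab M n.+1 x).2 =
          Some (e, (lab M n x).2),
        src e = (lab M n x).1 & rng e = (lab M n.+1 x).1].
    by have [_ p] := lab_edges M n; exact: pull_edge (p x).
  by have [e eP] := dep_choice H; exists e.
apply: (@infinite_inj _ _ e) => [x y xy|x n]; last first.
  by have [_ _ ->] := eP x n; have [_ -> _] := eP x n.+1.
apply: (lab_inj (l := M)); elim=> [|n IH]; first exact: lab0.
have [xe _ xr] := eP x n; have [ye _ yr] := eP y n.
have xy1 : (lab M n.+1 x).1 = (lab M n.+1 y).1 by rewrite -xr -yr xy.
move: xe ye; rewrite xy IH -xy1 => xe ye.
rewrite [LHS]surjective_pairing [RHS]surjective_pairing xy1; congr (_, _).
apply: (@onth_inj _ (expand (hgt M n \o @src _ _ (edges B n))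
   (fiber (edges B n) (lab M n.+1 x).1))); last by rewrite xe ye.
  by apply: expand_uniq; exact: fiber_uniq.
by rewrite gtn_min -!onthTE xe ye.
Qed.

End ModelDiagram.

(** * Minimal systems *)

Section Minimal.
Variables (X : topologicalType) (phi phi' : X -> X).
Hypotheses (phi_cont : continuous phi) (phi'_cont : continuous phi').
Hypotheses (phiK : cancel phi phi') (phi'K : cancel phi' phi).
Hypothesis compactX : compact [set: X].

Lemma iter_continuous (f : X -> X) k : continuous f -> continuous (iter k f).
Proof.
move=> cf; elim: k => [|k IH] x; first exact: cvg_id.
by apply: (@continuous_comp _ _ _ (iter k f) f); [exact: IH|exact: cf].
Qed.

Let open_iter (f : X -> X) k (U : set X) : continuous f -> open U ->
  open [set x | U (iter k f x)].
Proof.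
move=> cf oU; apply: (@open_comp _ _ (iter k f) U) => // x _.
exact: iter_continuous.
Qed.

Let iterK k l (x : X) : (k <= l)%N -> iter k phi' (iter l phi x) = iter (l - k) phi x.
Proof.
move=> kl; rewrite -{1}(subnKC kl) iterD.
by elim: k {kl} (iter (l - k) phi x) => // k IH y; rewrite iterSr iterS phiK.
Qed.

(** In a minimal system, all orbits visit a given non-empty open set within a
    bounded positive time. *)
Lemma minimal_recurrent (U : set X) : minimal_subset phi [set: X] ->
  open U -> U !=set0 ->
  exists N, forall x, exists2 i, (0 < i <= N)%N & U (iter i phi x).
Proof.
move=> [_ minX] oU [u Uu].
pose A n := [set x | forall k, (k <= n)%N -> ~ U (iter k phi x) /\ ~ U (iter k phi' x)].
(* A two-sided bound suffices: it is applied to a later point of the orbit. *)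
suff [n An] : exists n, forall x, ~ A n x.
  exists (n.+1 + n)%N => x.
  have /existsNP[k /not_implyP[kn /not_andP[/contrapT|/contrapT]]] := An (iter n.+1 phi x).
    by rewrite -iterD => ?; exists (k + n.+1)%N; rewrite // addnS addSn /= ltnS leq_add2r.
  rewrite iterK ?(leq_trans kn) // => ?; exists (n.+1 - k)%N => //.
  by rewrite subn_gt0 ltnS kn (leq_trans (leq_subr _ _)) // leq_addr.
(* Otherwise, by compactness, some full orbit avoids [U]; such points form a
   closed invariant set. *)
apply: contrapT => /forallNP H.
have [n|n x Ax k kn|n|x xA] := @compact_nested _ A compactX.
- have -> : A n = \bigcap_(k in [set k | (k <= n)%N])
      ((~` [set x | U (iter k phi x)]) `&` ~` [set x | U (iter k phi' x)]).
    by apply/seteqP; split.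
  apply: closed_bigI => k _; apply: closedI; apply: open_closedC;
    exact: open_iter.
- by apply: Ax; exact: leqW.
- by have /existsNP[x /contrapT] := H n; exists x.
pose D := [set y | forall k, ~ U (iter k phi y) /\ ~ U (iter k phi' y)].
have Dx : D x by move=> k; exact: (xA k k).
have DT : D = [set: X].
  apply: minX => //; split; first by exists x.
    have -> : D = \bigcap_(k in [set: nat])
        ((~` [set x | U (iter k phi x)]) `&` ~` [set x | U (iter k phi' x)]).
      by apply/seteqP; split=> y yD k; first (by move=> _; exact: yD); exact: yD.
    by apply: closed_bigI => k _; apply: closedI; apply: open_closedC;
      exact: open_iter.
  apply/seteqP; split=> [_ [y Dy <-] k|y Dy].
    split; first by rewrite -iterSr; have [] := Dy k.+1.
    case: k => [|k]; first by have [] := Dy 1%N.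
    by rewrite iterSr phiK; have [] := Dy k.
  exists (phi' y) => // k; split; last by rewrite -iterSr; have [] := Dy k.+1.
  case: k => [|k]; first by have [] := Dy 1%N.
  by rewrite iterSr phi'K; have [] := Dy k.
have : D u by rewrite DT.
by move=> /(_ 0%N)[].
Qed.

Variables (x0 : X) (B : ordered_bratteli) (M : model phi x0 B).

(** Points on a high enough top floor follow the orbit of [x0] for a while. *)
Lemma near_top k i : exists m, forall z, at_top M m z ->
  lab M k (iter i phi z) = lab M k (iter i phi x0).
Proof.
have oU : open [set z | lab M k (iter i phi z) = lab M k (iter i phi x0)].
  by apply: (@open_iter phi i [set z | lab M k z = _]) => //; exact: mlab_open.
have [n nP] := lab_basis compactX (mlab_open M) oU erefl.
have [|m mP] := lab_shrink compactX (mlab_open M)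
    (P := fun m c => c.2.+1 = hgt M m c.1) _ (mlab_top_uniq M) n.
  by move=> m x; exact: (top_le (leqnSn m)).
by exists m => z /mP /nP.
Qed.

(** Let [i] be the first positive time at which the orbit of [x0] visits the
    bottom floor of the tower [v].  The points of a high enough top floor visit
    the bottom of [v] at time [i] too, and do not come back to that top floor
    before; hence [v] is crossed by all the towers of that level. *)
Lemma model_simple : minimal_subset phi [set: X] -> simple_bratteli B.
Proof.
move=> minX n.
have /choice[m mP] : forall v : vert B n, exists m, forall m' (w : vert B m'),
    (m <= m')%N -> (n <= m')%N -> v \in word (espan B n m') w.
  move=> v.
  have [|N NP] := minimal_recurrent (U := [set x | lab M n x = (v, 0%N)]) minX (mlab_open M n _).
    by have [x xv] := lab_surj (hgt_gt0 M v); exists x.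
  have ex : exists i, (0 < i)%N && `[<lab M n (iter i phi x0) = (v, 0%N)>].
    have [i /andP[i0 _] xi] := NP x0; exists i; rewrite i0 /=; exact/asboolP.
  have [i /andP[i0 /asboolP xi] i_min] := ex_minnP ex.
  have [k kP] : exists k, forall j, (0 < j < i)%N -> ~ at_top M k (iter j phi x0).
    have /choice[k kP] : forall j, exists k, (0 < j < i)%N -> ~ at_top M k (iter j phi x0).
      move=> j; case: (boolP (0 < j < i)%N) => [/andP[j0 ji]|_]; last by exists 0%N.
      have [jx|/existsNP[k kx]] := pselect (forall k, at_top M k (iter j phi x0)).
        have jx0 := mlab_top_uniq M _ jx.
        (* A return of [x0] to itself would give an earlier visit. *)
        have : (i <= i - j)%N; last by rewrite leqNgt ltn_subrL j0 i0.
        apply: i_min; rewrite subn_gt0 ji /=; apply/asboolP.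
        by rewrite -[x0 in iter _ _ x0]jx0 -iterD subnK // ltnW.
      by exists k.
    exists (\max_(j < i) k j) => j /andP[j0 ji].
    have jk : (k j <= \max_(j < i) k j)%N by rewrite (leq_bigmax (Ordinal ji)).
    by apply: contra_not (top_le jk) _; apply: kP; rewrite j0.
  have [m1 m1P] := near_top n i.
  have /choice[m2 m2P] : forall j, exists m, forall z, at_top M m z ->
      lab M k (iter j phi z) = lab M k (iter j phi x0) := near_top k.
  exists (maxn (maxn m1 k) (\max_(j < i) m2 j)) => m w; rewrite !geq_max.
  move=> /andP[/andP[m1m km] m2m] nm.
  have [y yw] := lab_surj (hgt_gt0 M w).
  have zy : phi (phi' y) = y by rewrite phi'K.
  have zt : at_top M m (phi' y).
    by have [[_]|[]] // := mlab_step M m (phi' y); rewrite zy yw => -[].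
  have zj j : (j < i)%N -> lab M m (iter j.+1 phi (phi' y)) = (w, j).
    elim: j => [|j IH] ji; first by rewrite /= zy.
    have [[_]|[]] := mlab_step M m (iter j.+1 phi (phi' y)).
      by rewrite (IH (ltnW ji)) -iterS.
    move=> jt _; exfalso; have : at_top M k (iter j.+1 phi (phi' y)) by exact: top_le jt.
    have := kP j.+1 ji; rewrite /at_top -(m2P j.+1 (phi' y)) //.
    apply: top_le zt; apply: leq_trans m2m.
    exact: (leq_bigmax (Ordinal ji)).
  have [_ p] := lab_span M nm; have := p (iter i phi (phi' y)).
  rewrite (m1P _ (top_le m1m zt)) xi -(prednK i0) zj ?prednK // => /expand_mem.
  by [].
exists (maxn n.+1 (\max_v m v)) => [|v w]; first by rewrite leq_maxl.
apply/word_span; apply: mP; last by rewrite (leq_trans (leqnSn n)) ?leq_maxl.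
by rewrite leq_max [X in _ || X]leq_bigmax orbT.
Qed.

End Minimal.


(** * The path space of an ordered Bratteli diagram *)

Section PathSpace.
Variable B : ordered_bratteli.

(** The set X_B of infinite paths. *)
Definition path_space : Type := {e : forall n, edges B n | infinite_paths B e}.

(** The number of paths from the root to a vertex. *)
Fixpoint path_hgt n : vert B n -> nat :=
  if n is n'.+1 then fun w => size (expand (@path_hgt n') (word (edges B n') w))
  else fun _ => 1%N.

(** The rank of the initial segment of length [n] of a path, among the paths
    from the root with the same range; the last edges are compared first. *)
Fixpoint path_pos (e : forall n, edges B n) n : nat :=
  if n is n'.+1 then
    index (e n', path_pos e n')
      (expand (@path_hgt n' \o @src _ _ (edges B n')) (fiber (edges B n') (rng (e n'))))
  else 0%N.

(** The initial segments of length [n] with a given range form a tower, in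
    which a path is located by the rank of its own initial segment. *)
Definition path_lab n (x : path_space) : vert B n * nat :=
  (src (sval x n), path_pos (sval x) n).

Lemma path_hgt_gt0 n (v : vert B n) : (0 < path_hgt v)%N.
Proof.
elim: n v => // n IH w /=; have /word_rng := edges_rng w.
by case: (word _ _) => // v s _; rewrite size_expand_cons ltn_addr.
Qed.

Lemma path_lab_lt n x : ((path_lab n x).2 < path_hgt (path_lab n x).1)%N.
Proof.
case: x => e ep; elim: n => //= n IH.
rewrite -ep /word expand_map size_map index_mem mem_expand mem_fiber eqxx.
exact: IH.
Qed.

Lemma path_posP n (x : path_space) :
  onth (expand (@path_hgt n \o @src _ _ (edges B n))
    (fiber (edges B n) (rng (sval x n)))) (path_pos (sval x) n.+1) =
  Some (sval x n, path_pos (sval x) n).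
Proof.
by rewrite onth_index // mem_expand mem_fiber eqxx; exact: path_lab_lt n x.
Qed.

Lemma pathP (x : path_space) n : rng (sval x n) = src (sval x n.+1).
Proof. exact: (svalP x n). Qed.

Lemma path_lab_edges n : describes (edges B n) (@path_hgt n) (@path_hgt n.+1)
  (path_lab n) (path_lab n.+1) id.
Proof.
split=> // x; rewrite /pull /word expand_map onth_map.
have -> : (path_lab n.+1 x).1 = rng (sval x n) by rewrite pathP.
by rewrite [X in omap _ X]path_posP.
Qed.

Lemma path_lab_inj x y : (forall n, path_lab n x = path_lab n y) -> x = y.
Proof.
move=> xy; suff E : sval x = sval y.
  by case: x y E {xy} => [e ep] [e' e'p] /= E; apply: eq_exist.
apply: functional_extensionality_dep => n.
have sE : src (sval x n.+1) = src (sval y n.+1) := congr1 fst (xy n.+1).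
have pE : path_pos (sval x) n.+1 = path_pos (sval y) n.+1 := congr1 snd (xy n.+1).
by move: (path_posP n x) (path_posP n y); rewrite !pathP sE pE => -> [].
Qed.

(** Every floor of level [n] is the label of a path that follows a given
    coherent family of edges from level [n] on; the initial segment is obtained
    by descending from [v], one level at a time. *)
Let path_through n (v : vert B n) j (e : forall k, edges B k) :
  (j < path_hgt v)%N -> src (e n) = v ->
  (forall k, (n <= k)%N -> rng (e k) = src (e k.+1)) ->
  exists x, path_lab n x = (v, j).
Proof.
move=> jv ev eP; suff [x [<- _]] : exists x, path_lab n x = (v, j) /\
    forall k, (n <= k)%N -> sval x k = e k by exists x.
elim: n v j e jv ev eP => [|n IH] v j e jv ev eP.
  by exists (exist _ e (fun k => eP k (leq0n k))); rewrite /path_lab /= ev; case: j jv.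
have [[e' i] ei] : exists c, onth (expand (@path_hgt n \o @src _ _ (edges B n))
    (fiber (edges B n) v)) j = Some c.
  have := onthTE (expand (@path_hgt n \o @src _ _ (edges B n)) (fiber (edges B n) v)) j.
  by move: jv; rewrite /= /word expand_map size_map => ->; case: onth => // c; exists c.
have /eqP e'v : rng e' == v by rewrite -mem_fiber (expand_mem ei).
pose f := dfwith e e'.
have fn : f n = e' by rewrite /f dfwith_in.
have fk k : (n < k)%N -> f k = e k by move=> nk; rewrite /f dfwith_out // ltn_eqF.
have [||k|x [xn xk]] := IH (src e') i f; first exact: (expand_lt ei).
- by rewrite fn.
- rewrite leq_eqVlt => /orP[/eqP <-|nk]; first by rewrite fn fk // ev.
  by rewrite !fk ?(ltnW nk) // ?eP // ltnS ltnW.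
exists x; split; last by move=> k nk; rewrite xk ?(ltnW nk) // fk.
have x_n : sval x n = e' by rewrite xk // fn.
rewrite /path_lab -(pathP x n) x_n e'v; congr (_, _).
rewrite /= x_n e'v; move: xn => [_ ->].
rewrite -(onth_nth (e', i) _ _ _ ei) index_uniq //.
  by have := onthTE (expand (@path_hgt n \o @src _ _ (edges B n)) (fiber (edges B n) v)) j;
    rewrite ei.
by apply: expand_uniq; exact: fiber_uniq.
Qed.

(** The paths through [v] exist because every vertex is the source of an edge:
    [u] follows chosen edges, and is made to pass through [v] at level [n]. *)
Lemma path_lab_surj n (v : vert B n) j : (j < path_hgt v)%N ->
  exists x, path_lab n x = (v, j).
Proof.
have /dep_choice[d _] : forall k, exists _ : vert B k, True.
  by move=> k; have /card_gt0P[u _] := vert_neq0 B k; exists u.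
have /dep_choice[next nextP] : forall k, exists f : vert B k -> edges B k,
    forall u, src (f u) = u.
  by move=> k; have [f fP] := choice (@edges_src B k); exists f.
pose u := fix u k : vert B k := if k is k'.+1
  then dfwith (dfwith d (rng (next k' (u k')))) v k'.+1 else dfwith d v 0%N.
have un : u n = v by case: (n) v @u => [|m] w /=; rewrite dfwith_in.
move=> jv; apply: (path_through (e := fun k => next k (u k))) => //.
  by rewrite nextP.
by move=> k nk; rewrite nextP /= dfwith_out ?dfwith_in // ltn_eqF.
Qed.

Definition path_labelling : labelling path_space B :=
  Labelling path_hgt_gt0 (fun _ => erefl) path_lab_lt path_lab_surj
    path_lab_inj path_lab_edges.

Lemma path_complete : complete path_labelling.
Proof.
move=> c clt cS.
have /dep_choice[e eP] : forall n, exists e : edges B n,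
    [/\ onth (expand (@path_hgt n \o @src _ _ (edges B n))
          (fiber (edges B n) (c n.+1).1)) (c n.+1).2 = Some (e, (c n).2),
        src e = (c n).1 & rng e = (c n.+1).1].
  by move=> n; exact: pull_edge (cS n).
have ep : infinite_paths B e.
  by move=> n; have [_ _ ->] := eP n; have [_ -> _] := eP n.+1.
exists (exist _ e ep); elim=> [|n IH].
  rewrite /= /path_lab /=; have [_ -> _] := eP 0%N.
  by rewrite [RHS]surjective_pairing; congr (_, _); have := clt 0%N; case: (c 0%N).2.
rewrite /= /path_lab /= -/(path_pos e n).
have [_ -> _] := eP n.+1; rewrite [RHS]surjective_pairing; congr (_, _).
have [en _ er] := eP n; rewrite er.
have -> : path_pos e n = (c n).2 by rewrite -IH.
rewrite -(onth_nth (e n, (c n).2) _ _ _ en) index_uniq //.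
  have := onthTE (expand (@path_hgt n \o @src _ _ (edges B n))
    (fiber (edges B n) (c n.+1).1)) (c n.+1).2.
  by rewrite en.
by apply: expand_uniq; exact: fiber_uniq.
Qed.

(** The points lying on a top floor at every level are the paths of maximal
    edges, and dually. *)
Lemma path_top (x : path_space) :
  (forall n, at_top path_labelling n x) <-> forall n, maximal_edge (sval x n).
Proof.
split=> [xt n|xm].
  apply/maximal_edge_last; apply/esym.
  apply: (expand_last (sval x n) _ _ (path_posP n x)) => [e|].
    exact: path_hgt_gt0.
  have := xt n.+1; rewrite /at_top [X in X.+1]/= => ->.
  by rewrite -[(lab _ _ _).1]/(src (sval x n.+1)) -pathP /= /word expand_map size_map.
elim=> [|n IH]; first exact: top0.
rewrite /at_top -[(lab _ _ x).1]/(src (sval x n.+1)) -pathP /= /word expand_map size_map.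
apply: index_expand_top => //.
- by move=> e; exact: path_hgt_gt0.
- exact: fiber_uniq.
- by rewrite mem_fiber.
- exact/maximal_edge_last.
Qed.

Lemma path_bottom (x : path_space) :
  (forall n, at_bottom path_labelling n x) <-> forall n, minimal_edge (sval x n).
Proof.
split=> [xb n|xm].
  apply/minimal_edge_head; apply/esym.
  apply: (expand_head (h := @path_hgt n \o @src _ _ (edges B n))
    (c := (sval x n, path_pos (sval x) n)) (sval x n)) => [e|].
    exact: path_hgt_gt0.
  by have := path_posP n x; rewrite [path_pos _ _](xb n.+1).
elim=> [|n IH] //.
apply: index_expand_bottom => //.
- by move=> e; exact: path_hgt_gt0.
- by rewrite mem_fiber.
- exact/minimal_edge_head.
Qed.

End PathSpace.

(** * The successor map of a labelled space *)

Section Successor.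
Variables (X : Type) (B : ordered_bratteli) (L : labelling X B).
Hypothesis L_complete : complete L.

(** A relation that passes down to lower levels, and that determines the
    floors of [y] from those of [x] from level [n0] on, is realized by a point
    as soon as it is realized level by level. *)
Lemma lift_relation (r : forall n, vert B n * nat -> vert B n * nat -> Prop) x n0 :
  (forall n m y, (n <= m)%N -> r m (lab L m x) (lab L m y) ->
    r n (lab L n x) (lab L n y)) ->
  (forall n y y', (n0 <= n)%N -> r n (lab L n x) (lab L n y) ->
    r n (lab L n x) (lab L n y') -> lab L n y = lab L n y') ->
  (forall n, (n0 <= n)%N -> exists y, r n (lab L n x) (lab L n y)) ->
  exists y, forall n, r n (lab L n x) (lab L n y).
Proof.
move=> r_le r_fun r_ex.
have /choice[z zP] : forall n, exists y, (n0 <= n)%N -> r n (lab L n x) (lab L n y).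
  move=> n; case: (leqP n0 n) => [/r_ex[y yP]|_]; first by exists y.
  by exists x.
pose c n := lab L n (z (maxn n n0)).
have cE n m : (n <= m)%N -> lab L n (z (maxn m n0)) = c n.
  move=> nm; apply: (lab_le (leq_maxl n n0)).
  have km : (maxn n n0 <= maxn m n0)%N by rewrite geq_max leq_max nm leq_maxr.
  apply: r_fun; [exact: leq_maxr|apply: (r_le _ _ _ km)|];
    by apply: zP; exact: leq_maxr.
have [n|n|y yc] := L_complete (c := c); first exact: lab_lt.
  have [_ p] := lab_edges L n.
  by rewrite [c n.+1]/(lab L n.+1 (z (maxn n.+1 n0))) p /= cE.
exists y => n; rewrite yc; apply: (r_le _ _ _ (leq_maxl n n0)).
by apply: zP; exact: leq_maxr.
Qed.

Variables (xmax xmin : X).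
Hypotheses (top_xmax : forall n, at_top L n xmax)
  (bottom_xmin : forall n, at_bottom L n xmin)
  (xmax_uniq : forall x, (forall n, at_top L n x) -> x = xmax)
  (xmin_uniq : forall x, (forall n, at_bottom L n x) -> x = xmin).

Lemma successor_exists x :
  exists y, forall n, step (hgt L n) (lab L n x) (lab L n y).
Proof.
have [xt|/existsNP[n0 xt]] := pselect (forall n, at_top L n x).
  by exists xmin => n; right; split; [exact: xt|exact: bottom_xmin].
have xtn n : (n0 <= n)%N -> ~ at_top L n x by move=> nn; apply: contra_not xt; exact: top_le.
apply: (@lift_relation (fun n => step (hgt L n)) x n0).
- by move=> n m y; exact: step_le.
- by move=> n y y' /xtn xn [[_ ->]|[/xn[]]] [[_ ->]|[/xn[]]].
- move=> n /xtn xn; have := lab_lt L n x; rewrite leq_eqVlt => /orP[/eqP/xn //|xlt].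
  by have [y yE] := lab_surj xlt; exists y; left.
Qed.

Lemma predecessor_exists y :
  exists x, forall n, step (hgt L n) (lab L n x) (lab L n y).
Proof.
have [yb|/existsNP[n0 yb]] := pselect (forall n, at_bottom L n y).
  by exists xmax => n; right; split; [exact: top_xmax|exact: yb].
have ybn n : (n0 <= n)%N -> ~ at_bottom L n y.
  by move=> nn; apply: contra_not yb; exact: bottom_le.
apply: (@lift_relation (fun n c d => step (hgt L n) d c) y n0).
- by move=> n m x; exact: step_le.
- move=> n x x' /ybn yn [[_ E]|[_ /yn[]]] [[_ E']|[_ /yn[]]].
  move: E; rewrite E' => -[E1 E2].
  by rewrite [LHS]surjective_pairing [RHS]surjective_pairing E1 E2.
- move=> n /ybn yn; have y0 : (0 < (lab L n y).2)%N by rewrite lt0n; exact/eqP.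
  have [|x xE] := @lab_surj _ _ L n (lab L n y).1 (lab L n y).2.-1.
    by apply: leq_ltn_trans (leq_pred _) (lab_lt L n y).
  exists x; left; rewrite xE /= prednK //; split; first exact: lab_lt.
  exact: surjective_pairing.
Qed.

(** The Vershik map and its inverse: every point moves one floor up at the levels
    at which this is possible, and the maximal point is sent to the minimal one. *)
Lemma vershik_map : exists f g : X -> X,
  [/\ cancel f g, cancel g f &
     forall n x, step (hgt L n) (lab L n x) (lab L n (f x))].
Proof.
have [f fP] := choice successor_exists; have [g gP] := choice predecessor_exists.
exists f, g; split=> [x|x|n x]; last exact: fP.
- apply: (step_cofun (L := L) (y := f x)) => // z z' zt z't.
  by rewrite (xmax_uniq zt) (xmax_uniq z't).
- apply: (step_fun (L := L) (x := g x)) => // z z' zt z't.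
  by rewrite (xmin_uniq zt) (xmin_uniq z't).
Qed.

End Successor.

Section SuccessorContinuous.
Variables (X : topologicalType) (B : ordered_bratteli) (L : labelling X B).
Hypotheses (compactX : compact [set: X])
  (lab_open : forall n c, open [set x | lab L n x = c]).
Variables (xmax xmin : X).
Hypotheses
  (xmax_uniq : forall x, (forall n, at_top L n x) -> x = xmax)
  (xmin_uniq : forall x, (forall n, at_bottom L n x) -> x = xmin).
Variables (f g : X -> X).
Hypotheses (fS : forall n x, step (hgt L n) (lab L n x) (lab L n (f x)))
  (gK : cancel g f).

Lemma successor_continuous : continuous f.
Proof.
apply: (lab_continuous compactX lab_open) => n x.
have [xt|/existsNP[n0 xt]] := pselect (forall n, at_top L n x).
  have [|m mP] := lab_shrink compactX lab_open (P := fun m c => c.2 = 0%N) _ xmin_uniq n.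
    by move=> m y; exact: (bottom_le (leqnSn m)).
  have fb z : at_top L m z -> lab L n (f z) = lab L n xmin.
    by move=> zt; apply: mP; have [[]|[]] // := fS m z; rewrite zt ltnn.
  apply: filterS (lab_nbhs lab_open m x) => z /= zx.
  by rewrite (fb x (xt m)) fb // /at_top zx; exact: xt.
apply: filterS (lab_nbhs lab_open (maxn n n0) x) => z /= zx.
apply: (lab_le (leq_maxl n n0)).
have xk : ~ at_top L (maxn n n0) x by apply: contra_not xt; exact/top_le/leq_maxr.
have [[_ ->]|[]] := fS (maxn n n0) x; last by move=> /xk.
by have [[_ ->]|[]] := fS (maxn n n0) z; rewrite zx // => /xk.
Qed.

Lemma predecessor_continuous : continuous g.
Proof.
apply: (lab_continuous compactX lab_open) => n x.
have gS m z : step (hgt L m) (lab L m (g z)) (lab L m z) by rewrite -{2}[z]gK.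
have [xb|/existsNP[n0 xb]] := pselect (forall n, at_bottom L n x).
  have [|m mP] := lab_shrink compactX lab_open
      (P := fun m c => c.2.+1 = hgt L m c.1) _ xmax_uniq n.
    by move=> m y; exact: (top_le (leqnSn m)).
  have gt z : at_bottom L m z -> lab L n (g z) = lab L n xmax.
    move=> zb; apply: mP; have [[_ E]|[]] // := gS m z.
    by move: zb; rewrite /at_bottom E.
  apply: filterS (lab_nbhs lab_open m x) => z /= zx.
  by rewrite (gt x (xb m)) gt // /at_bottom zx; exact: xb.
apply: filterS (lab_nbhs lab_open (maxn n n0) x) => z /= zx.
apply: (lab_le (leq_maxl n n0)).
have xk : ~ at_bottom L (maxn n n0) x.
  by apply: contra_not xb; exact/bottom_le/leq_maxr.
have [[_ E]|[_ /xk //]] := gS (maxn n n0) x.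
have [[_ E']|[]] := gS (maxn n n0) z; last by rewrite zx => _ /xk.
move: E'; rewrite zx E => -[E1 E2].
by rewrite [LHS]surjective_pairing [RHS]surjective_pairing E1 E2.
Qed.

End SuccessorContinuous.

Section SimpleMinimal.
Variables (X : topologicalType) (phi : X -> X) (x0 : X).
Variables (B : ordered_bratteli) (M : model phi x0 B).
Hypothesis compactX : compact [set: X].

(** An invariant set that meets a tower meets all its floors. *)
Lemma invariant_floors (N : set X) m w i j : phi @` N = N ->
  (i < hgt M m w)%N -> (j < hgt M m w)%N ->
  (exists2 y, N y & lab M m y = (w, i)) -> exists2 y, N y & lab M m y = (w, j).
Proof.
move=> Ninv iw jw Ni.
have down k : (k.+1 < hgt M m w)%N -> (exists2 y, N y & lab M m y = (w, k.+1)) ->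
    exists2 y, N y & lab M m y = (w, k).
  move=> kw [y Ny yw]; have [y' Ny' y'y] : (phi @` N) y by rewrite Ninv.
  exists y' => //.
  have [[_ E]|[_ E]] := mlab_step M m y'; last by rewrite y'y yw in E.
  move: E; rewrite y'y yw => -[-> ->]; exact: surjective_pairing.
have up k : (k.+1 < hgt M m w)%N -> (exists2 y, N y & lab M m y = (w, k)) ->
    exists2 y, N y & lab M m y = (w, k.+1).
  move=> kw [y Ny yw]; exists (phi y); first by rewrite -Ninv; exists y.
  by have [[_]|[]] := mlab_step M m y; rewrite yw //= => kw'; rewrite -kw' ltnn in kw.
have {Ni} N0 : exists2 y, N y & lab M m y = (w, 0%N).
  by elim: i iw Ni => // i IH iw /(down _ iw); apply: IH; exact: ltnW.
by elim: j jw => // j IH jw; apply: up => //; apply: IH; exact: ltnW.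
Qed.

(** When the diagram is simple, a tower of a high enough level crosses every
    floor of level [n], so that closed invariant sets are dense. *)
Lemma simple_minimal : simple_bratteli B ->
  forall N, closed_invariant phi N -> N = [set: X].
Proof.
move=> simpleB N [[y Ny] cN Ninv]; apply/seteqP; split=> // x _.
apply: contrapT => Nx.
have [n nP] := lab_basis compactX (mlab_open M) (closed_openC cN) Nx.
have [m nm mP] := simpleB n; have [_ p] := lab_span M (ltnW nm).
have vw : (lab M n x).1 \in word (espan B n m) (lab M m y).1 by apply/word_span; exact: mP.
have /onthP[j jE] : lab M n x \in expand (hgt M n) (word (espan B n m) (lab M m y).1).
  by rewrite [lab M n x]surjective_pairing mem_expand vw lab_lt.
have [st _] := lab_span M (ltnW nm).
have jw : (j < hgt M m (lab M m y).1)%N by rewrite st -onthTE jE.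
have [z Nz zE] : exists2 z, N z & lab M m z = ((lab M m y).1, j).
  apply: invariant_floors Ninv (lab_lt M m y) jw _.
  by exists y; rewrite // -surjective_pairing.
suff : ~ N z by [].
by apply: nP; have := p z; rewrite zE /pull jE => -[].
Qed.

End SimpleMinimal.


(** * The topology of a labelled space *)

(** The set [T], with base point [x0], metrized by the least level at which
    labels differ. *)
Definition labelled_space (R : realType) (T : Type) (B : ordered_bratteli)
  (L : labelling T B) (x0 : T) : Type := T.

Section LabelledSpace.
Variables (R : realType) (T : Type) (B : ordered_bratteli) (L : labelling T B).
Variable x0 : T.

Local Notation X := (labelled_space R L x0).

HB.instance Definition _ := gen_eqMixin X.
HB.instance Definition _ := gen_choiceMixin X.
HB.instance Definition _ := isPointed.Build X x0.

(** The inverse of [n.+1], for the least [n] at which the labels differ. *)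
Definition lab_dist (x y : X) : R :=
  if pselect (exists n, `[<lab L n x <> lab L n y>]) is left ex
  then (ex_minn ex).+1%:R^-1%R else 0%R.

Lemma lab_dist_ge0 x y : (0 <= lab_dist x y)%R.
Proof. by rewrite /lab_dist; case: pselect => [ex|_]; rewrite ?invr_ge0 ?ler0n. Qed.

Lemma lab_dist_lt n x y :
  (lab_dist x y < n.+1%:R^-1)%R <-> lab L n x = lab L n y.
Proof.
rewrite /lab_dist; case: pselect => [ex|nex]; last first.
  split=> [_|_]; last by rewrite invr_gt0 ltr0n.
  by apply: contrapT => xy; apply: nex; exists n; apply/asboolP.
case: ex_minnP => m /asboolP xy m_min.
rewrite ltf_pV2 ?posrE ?ltr0n // ltr_nat ltnS; split=> [nm|xyn].
  apply: contrapT => xyn; have := m_min n; rewrite leqNgt nm => H.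
  by suff: false by []; apply: H; apply/asboolP.
by rewrite ltnNge; apply/negP => mn; apply: xy; exact: lab_le mn xyn.
Qed.

(** The distance is governed by the levels at which labels differ. *)
Lemma lab_dist_le x y (r : R) : (0 <= r)%R ->
  (forall n, lab L n x <> lab L n y -> (n.+1%:R^-1 <= r)%R) -> (lab_dist x y <= r)%R.
Proof.
move=> r0 xyr; rewrite /lab_dist; case: pselect => [ex|_] //.
by case: ex_minnP => m /asboolP /xyr.
Qed.

Lemma lab_dist_ge n x y : lab L n x <> lab L n y -> (n.+1%:R^-1 <= lab_dist x y)%R.
Proof. by move=> xy; rewrite leNgt; apply/negP => /lab_dist_lt. Qed.

Lemma lab_distxx x : lab_dist x x = 0%R.
Proof.
by apply/eqP; rewrite eq_le lab_dist_ge0 andbT; apply: lab_dist_le.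
Qed.

Lemma lab_dist_eq0 x y : lab_dist x y = 0%R -> x = y.
Proof.
by move=> xy; apply: (lab_inj (l := L)) => n; apply/lab_dist_lt; rewrite xy invr_gt0 ltr0n.
Qed.

Lemma lab_dist_sym x y : lab_dist x y = lab_dist y x.
Proof.
apply/eqP; rewrite eq_le; apply/andP; split; apply: lab_dist_le (lab_dist_ge0 _ _) _ => n xy;
  by apply: lab_dist_ge => /esym.
Qed.

Lemma lab_dist_triangle y x z : (lab_dist x z <= lab_dist x y + lab_dist y z)%R.
Proof.
apply: lab_dist_le => [|n xz]; first by rewrite addr_ge0 ?lab_dist_ge0.
have [xy|xy] := pselect (lab L n x = lab L n y).
  rewrite -[X in (X <= _)%R]add0r lerD ?lab_dist_ge0 //.
  by apply: lab_dist_ge; rewrite -xy.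
by rewrite -[X in (X <= _)%R]addr0 lerD ?lab_dist_ge0 // lab_dist_ge.
Qed.

HB.instance Definition _ :=
  isMetric.Build R X lab_distxx lab_dist_eq0 lab_dist_sym lab_dist_triangle.

Lemma nbhs_labP (x : X) (A : set X) :
  nbhs x A <-> exists n, forall y, lab L n y = lab L n x -> A y.
Proof.
rewrite -nbhs_ballE; split=> [[e /= e0 xeA]|[n nA]].
  have [n ne] := ltr_add_invr e0; rewrite add0r in ne.
  exists n => y yx; apply: xeA; rewrite ballEmdist /=.
  by apply: lt_trans ne; apply/lab_dist_lt.
exists n.+1%:R^-1%R; first by rewrite /= invr_gt0 ltr0n.
by move=> y; rewrite ballEmdist /= => /lab_dist_lt xy; apply: nA.
Qed.

Lemma labelled_open n c : open [set x : X | lab L n x = c].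
Proof.
rewrite openE => x /= xc; apply/nbhs_labP; exists n => y /= ->.
exact: xc.
Qed.

(** At each level an ultrafilter selects a floor; these floors are coherent and
    determine the limit. *)
Lemma labelled_compact : complete L -> compact [set: X].
Proof.
move=> Lc; rewrite compact_ultra => F FU _.
have /dep_choice[c cP] : forall n, exists c : vert B n * nat, F [set x | lab L n x = c].
  move=> n; apply: contrapT => /forallNP H.
  pose I := {v : vert B n & 'I_(hgt L n v)}.
  have FI : F [set x | forall i : I, lab L n x <> (tag i, tagged i : nat)].
    apply: filter_forall => i.
    by have [/H|] := in_ultra_setVsetC [set x | lab L n x = (tag i, tagged i : nat)] FU.
  have [x] := filter_ex FI.
  move=> /(_ (existT _ (lab L n x).1 (Ordinal (lab_lt L n x)))) /=.
  by rewrite -surjective_pairing.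
have [n|n|x xc] := Lc c.
- by have [x <-] := filter_ex (cP n); exact: lab_lt.
- have [x [/= <- <-]] := filter_ex (filterI (cP n.+1) (cP n)).
  by have [_ ->] := lab_edges L n.
- exists x; split=> // A /nbhs_labP[n nA].
  by apply: filterS (cP n) => y /= yc; apply: nA; rewrite yc xc.
Qed.

End LabelledSpace.

Lemma labelled_zero_dimensional (R : realType) (T : Type) (B : ordered_bratteli)
    (L : labelling T B) (x0 : T) : zero_dimensional (labelled_space R L x0).
Proof.
set X := labelled_space R L x0.
move=> x y xy; have [n nxy] : exists n, lab L n x <> lab L n y.
  apply: contrapT => /forallNP H; move/eqP: xy; apply.
  by apply: (lab_inj (l := L)) => n; apply: contrapT; exact: H.
exists [set z | lab L n z = lab L n x]; split=> //; last exact: nesym.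
split; first exact: labelled_open.
exact: (@closed_lab X B L (@labelled_open R T B L x0) n (fun c => c = lab L n x)).
Qed.

Lemma labelled_cantor (R : realType) (T : Type) (B : ordered_bratteli)
    (L : labelling T B) (x0 : T) : complete L ->
  (forall x : labelled_space R L x0, ~ open [set x]) ->
  homeomorphic (labelled_space R L x0) cantor_space.
Proof.
set X := labelled_space R L x0 => Lc perfectX.
have cantorX : cantor_like X.
  split; [exact/perfectTP|exact: labelled_compact|exact: metric_hausdorff|].
  exact: labelled_zero_dimensional.
have [f [f_cont f_closed]] := homeomorphism_cantor_like cantorX.
have fK : cancel f f^-1%FUN by move=> x; apply: funK; rewrite inE.
have Kf : cancel f^-1%FUN f by move=> x; apply: invK; rewrite inE.
exists (f^-1%FUN : X -> cantor_space); split; last by exists f.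
apply/continuous_closedP => A cA.
have -> : f^-1%FUN @^-1` A = f @` A.
  apply/seteqP; split=> [x Ax|_ [c Ac <-]]; first by exists (f^-1%FUN x).
  by rewrite /preimage /= fK.
exact: f_closed.
Qed.

(** * The Kakutani-Rokhlin partitions of a labelled system *)

Section ModelKR.
Variables (X : topologicalType) (phi : X -> X) (x0 : X).
Variables (B : ordered_bratteli) (M : model phi x0 B).
Hypothesis compactX : compact [set: X].
Hypothesis phi_surj : forall x, exists x', phi x' = x.

Section Level.
Variable n : nat.

Let height (k : 'I_#|vert B n|) := hgt M n (enum_val k).

Let floors (k : 'I_#|vert B n|) (j : 'I_(height k)) : set X :=
  [set x | lab M n x = (enum_val k, j : nat)].

Let floorsP x : exists k (j : 'I_(height k)), lab M n x = (enum_val k, j : nat).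
Proof.
have xlt : ((lab M n x).2 < height (enum_rank (lab M n x).1))%N.
  by rewrite /height enum_rankK lab_lt.
exists (enum_rank (lab M n x).1), (Ordinal xlt).
by rewrite enum_rankK -surjective_pairing.
Qed.

Let top := [set x | exists k (j : 'I_(height k)), j.+1 = height k /\ floors j x].
Let bottom := [set x | exists k (j : 'I_(height k)), j = 0 :> nat /\ floors j x].

Let topE x : top x <-> at_top M n x.
Proof.
split=> [[k [j [jk xkj]]]|xt]; first by rewrite /at_top xkj.
have [k [j xkj]] := floorsP x; exists k, j; split=> //.
by move: xt; rewrite /at_top xkj.
Qed.

Let bottomE x : bottom x <-> at_bottom M n x.
Proof.
split=> [[k [j [jk xkj]]]|xt]; first by rewrite /at_bottom xkj.
have [k [j xkj]] := floorsP x; exists k, j; split=> //.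
by move: xt; rewrite /at_bottom xkj.
Qed.

Let floors_neq0 k (j : 'I_(height k)) : floors j !=set0.
Proof. by have [x xE] := lab_surj (ltn_ord j); exists x. Qed.

Let floors_clopen k (j : 'I_(height k)) : clopen (floors j).
Proof.
split; first exact: mlab_open.
exact: (@closed_lab X B M (mlab_open M) n (fun c => c = (enum_val k, j : nat))).
Qed.

Let floors_disjoint : trivIset setT
  (fun i : {k : 'I_#|vert B n| & 'I_(height k)} => floors (tagged i)).
Proof.
move=> [k j] [k' j'] _ _ [x /= []]; rewrite /floors /= => -> [/enum_val_inj kk].
by case: _ / kk j' => j' jj; congr existT; apply: val_inj.
Qed.

Let floors_next k (i j : 'I_(height k)) :
  j = i.+1 :> nat -> phi @` floors i = floors j.
Proof.
move=> ji; apply/seteqP; split=> [_ [x xi <-]|x xj].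
  rewrite /floors /= ji; have [[_]|[]] := mlab_step M n x; rewrite xi //=.
  by move=> iE; have := ltn_ord j; rewrite ji /= iE ltnn.
have [x' x'x] := phi_surj x; exists x' => //.
have [[_ E]|[_ E]] := mlab_step M n x'; last by rewrite x'x xj ji in E.
move: E; rewrite x'x xj ji /floors /= => -[-> ->]; exact: surjective_pairing.
Qed.

Let top_bottom : phi @` top = bottom.
Proof.
apply/seteqP; split=> [_ [x /topE xt <-]|x /bottomE xb].
  by apply/bottomE; have [[]|[]] // := mlab_step M n x; rewrite xt ltnn.
have [x' x'x] := phi_surj x; exists x' => //; apply/topE.
by have [[_ E]|[]] // := mlab_step M n x'; move: xb; rewrite -x'x /at_bottom E.
Qed.

(** The towers are the vertices of level [n]. *)
Definition model_partition : kr_partition phi x0 :=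
  @KRPartition X phi x0 _ height floors (fun k => hgt_gt0 M (enum_val k))
    floors_neq0 floors_clopen floorsP floors_disjoint floors_next
    ((topE x0).2 (mlab_top M n)) top_bottom.

Lemma model_topE x : kr_top model_partition x <-> at_top M n x.
Proof. exact: topE. Qed.

Lemma model_atoms A : kr_atoms model_partition A <->
  exists2 x, A x & A = [set y | lab M n y = lab M n x].
Proof.
split=> [[k [j ->]]|[x _ ->]].
  have [x xkj] := floors_neq0 j; exists x => //.
  by apply/seteqP; split=> y; rewrite /= xkj.
have [k [j xkj]] := floorsP x; exists k, j.
by apply/seteqP; split=> y; rewrite /= xkj.
Qed.

End Level.

Lemma model_system : inhabited (kr_system phi x0).
Proof.
constructor; apply: (@KRSystem _ _ _ model_partition).
- apply/seteqP; split=> [A /model_atoms[x _ ->]|_ ->] /=.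
    by apply/seteqP; split=> // y _; exact: lab0.
  apply/model_atoms; exists x0 => //.
  by apply/seteqP; split=> // y _; exact: lab0.
- move=> n A /model_atoms[x _ ->]; exists [set y | lab M n y = lab M n x].
    by apply/model_atoms; exists x.
  by move=> y; exact: lab_le.
- by move=> n _ x /model_topE xt; apply/model_topE; exact: top_le xt.
- apply/seteqP; split=> [x xt|_ -> n _]; last by apply/model_topE; exact: mlab_top.
  apply: (mlab_top_uniq M) => -[|n]; first exact: top0.
  by apply/model_topE; exact: xt.
- split=> [A [n _ /model_atoms[x _ ->]]|x U].
    exact: mlab_open.
  rewrite nbhsE => -[V [oV Vx] VU].
  have [n nV] := lab_basis compactX (mlab_open M) oV Vx.
  exists [set y | lab M n y = lab M n x]; last by move=> y /nV /VU.
  by split=> //; exists n => //; apply/model_atoms; exists x.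
Qed.

End ModelKR.


(** * The system of a simple properly ordered diagram *)

(** If [x] is isolated, every orbit visits [x] within a bounded time. *)
Lemma isolated_finite (X : topologicalType) (phi phi' : X -> X) (x : X) :
  continuous phi -> continuous phi' -> cancel phi phi' -> cancel phi' phi ->
  compact [set: X] -> minimal_subset phi [set: X] -> open [set x] ->
  finite_set [set: X].
Proof.
move=> c c' K K' cX minX ox.
have [N NP] := minimal_recurrent c c' K K' cX minX ox (ex_intro _ x erefl).
apply: sub_finite_set (finite_image (fun i => iter i phi' x) (finite_II N.+1)) => y _.
have [i /andP[_ iN] <-] := NP y; exists i; first by rewrite /= ltnS.
by elim: i {iN} y => // i IH y; rewrite iterSr [iter i.+1 phi y]iterS K IH.
Qed.

Lemma diagram_object (R : realType) (B : ordered_bratteli) :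
  properly_ordered B -> simple_bratteli B -> infinite_set (infinite_paths B) ->
  exists X : sds_object R, cantor_minimal X /\
    inhabited (model (@sds_map R X) (@sds_base R X) B).
Proof.
move=> [[emax [[pmax mmax] umax]] [emin [[pmin mmin] umin]]] simpleB infB.
pose L := path_labelling B.
pose xmax : path_space B := exist _ emax pmax.
pose xmin : path_space B := exist _ emin pmin.
have Lc : complete L := @path_complete B.
have top_xmax n : at_top L n xmax by move: n; exact/path_top.
have bottom_xmin n : at_bottom L n xmin by move: n; exact/path_bottom.
have xmax_uniq (x : path_space B) : (forall n, at_top L n x) -> x = xmax.
  by case: x => e ep /path_top /= em; apply: eq_exist; rewrite (umax e).
have xmin_uniq (x : path_space B) : (forall n, at_bottom L n x) -> x = xmin.
  by case: x => e ep /path_bottom /= em; apply: eq_exist; rewrite (umin e).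
have [f [g [fK gK fS]]] := vershik_map Lc top_xmax bottom_xmin xmax_uniq xmin_uniq.
pose X : topologicalType := labelled_space R L xmax.
have oL n c : open [set x : X | lab L n x = c] := @labelled_open R _ B L xmax n c.
have cX : compact [set: X] by exact: labelled_compact.
have f_cont : continuous (f : X -> X) by exact: (successor_continuous cX oL xmin_uniq fS).
have g_cont : continuous (g : X -> X) by exact: (predecessor_continuous cX oL xmax_uniq fS gK).
pose M : @model X f xmax B := @Model X f xmax B L oL fS top_xmax xmax_uniq.
have f_surj (x : X) : exists x', f x' = x by exists (g x).
have fT : f @` [set: X] = [set: X].
  by apply/seteqP; split=> // x _; have [x' <-] := f_surj x; exists x'.
have inv_T := simple_minimal M cX simpleB.
have minX : @minimal_subset X f [set: X].
  split; first by split=> //; exists xmax.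
  by move=> N /inv_T.
have infX : infinite_set [set: X].
  move=> Tfin; apply: infB.
  apply: sub_finite_set (finite_image (fun x : X => sval (x : path_space B)) Tfin) => e ep.
  by exists (exist _ e ep).
have cantorX : homeomorphic X cantor_space.
  apply: labelled_cantor => // x ox; apply: infX.
  exact: (isolated_finite f_cont g_cont fK gK cX minX ox).
have [S] := model_system M cX f_surj.
have metX : metrizable R X.
  have id_cont : continuous (@id X) by move=> x; exact: cvg_id.
  by exists (labelled_space R L xmax : metricType R), id; split=> //; exists id.
have tdX : totally_disconnected [set: X].
  exact/zero_dimension_totally_disconnected/labelled_zero_dimensional.
have homX : @homeomorphism X X f by split=> //; exists g; split.
have minimalE N : @minimal_subset X f N -> N = [set: X].
  by move=> [/inv_T].
have essX : exists! N, @minimal_subset X f N.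
  by exists [set: X]; split=> // N /minimalE.
have baseX : exists2 N, @minimal_subset X f N & N xmax by exists [set: X].
exists (@SDSObject R X f xmax S metX cX tdX homX essX baseX).
by split; [split|exists].
Qed.

(** * The equivalence *)

Section MinimalObject.
Variables (R : realType) (X : sds_object R).
Hypothesis minX : cantor_minimal X.

Lemma sds_map_surj (x : X) : exists x', sds_map x' = x.
Proof.
by have [_ [g [_ _ gK]]] := sds_homeo X; exists (g x).
Qed.

Lemma cantor_infinite : infinite_set [set: cantor_space].
Proof.
apply: (@infinite_inj _ _ (fun n : nat => (fun m => m == n) : cantor_space)) => //.
  by move=> n m /(congr1 (fun f : cantor_space => f n)); rewrite eqxx => /esym/eqP.
exact: infinite_nat.
Qed.

Lemma cantor_minimal_infinite : infinite_set [set: X].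
Proof.
have [[f [_ [g [_ _ gK]]]] _] := minX.
apply: (@infinite_inj _ _ g) => //; first exact: can_inj gK.
exact: cantor_infinite.
Qed.

Lemma cantor_minimal_separated (x y : X) : x <> y ->
  exists U : set X, [/\ open U, U x & ~ U y].
Proof.
have [[f [f_cont [g [_ fK _]]]] _] := minX => xy.
exists (f @^-1` (~` [set f y])); split=> [||].
- apply: open_comp => [z _|]; first exact: f_cont.
  apply: closed_openC; apply: accessible_closed_set1.
  exact: (hausdorff_accessible cantor_space_hausdorff).
- by move=> /(can_inj fK).
- by apply.
Qed.

Lemma object_diagram : exists2 B,
  properly_ordered B /\ simple_bratteli B /\ infinite_set (infinite_paths B) &
  inhabited (model (@sds_map R X) (@sds_base R X) B).
Proof.
have [B [M]] := kr_model (sds_kr X) sds_map_surj cantor_minimal_separated.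
have cX := @sds_compact R X.
have [f_cont [g [g_cont fK gK]]] := sds_homeo X.
exists B; last by exists.
split; first exact: (model_properly_ordered M cX sds_map_surj).
split; last exact: (model_infinite_paths M cantor_minimal_infinite).
by have [_] := minX; exact: (model_simple f_cont g_cont fK gK cX M).
Qed.

End MinimalObject.

(** The image of an equivariant map is closed and invariant, hence everything. *)
Lemma sds_hom_surj (R : realType) (X Y : sds_object R) (a : sds_hom X Y) :
  cantor_minimal Y -> forall y, exists x, sval a x = y.
Proof.
move=> [hY [_ minY]] y; case: a => a [a_cont a_equiv _] /=.
suff aT : a @` [set: X] = [set: Y].
  have [x _ <-] : (a @` [set: X]) y by rewrite aT.
  by exists x.
have hausY : hausdorff_space Y.
  have [f [f_cont [g [_ fK _]]]] := hY.
  move=> p q pq; apply: (can_inj fK); apply: cantor_space_hausdorff => U V Uf Vf.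
  by have [z [Uz Vz]] := pq _ _ (f_cont p U Uf) (f_cont q V Vf); exists (f z).
apply: minY => //; split.
- by exists (a (sds_base X)); exists (sds_base X).
- apply: (compact_closed hausY); apply: continuous_compact; last exact: sds_compact.
  exact: continuous_subspaceT.
- apply/seteqP; split=> [_ [_ [x _ <-] <-]|_ [x _ <-]].
    by exists (sds_map x); rewrite // a_equiv.
  have [x' <-] := sds_map_surj x; rewrite a_equiv.
  by exists (a x') => //; exists x'.
Qed.

Theorem corollary4p4 (R : realType) :
  contravariantly_equivalent
    (full_subcategory (C := OBD_po) (fun B =>
       simple_bratteli (sval B) /\ infinite_set (infinite_paths (sval B))))
    (full_subcategory (C := SDS R) (fun X => cantor_minimal X)).
Proof.
set BD := full_subcategory (C := OBD_po) _.
set DS := @full_subcategory (SDS R) _.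
right.
have /dep_choice[obj _] : forall d : DS, exists _ : {c : BD &
    model (@sds_map R (sval d)) (@sds_base R (sval d)) (sval (sval c))}, True.
  move=> d; have [B [poB goodB] [M]] := object_diagram (svalP d).
  by exists (existT _ (exist _ (exist _ B poB) goodB : BD) M).
pose Fo d : BD := projT1 (obj d).
pose mdl d := projT2 (obj d).
have cX (d : DS) : compact [set: sval d] := @sds_compact R (sval d).
have sX (d : DS) := @sds_map_surj R (sval d).
have pm_exists (d d' : DS) (a : hom d d') (B C : BD)
    (M : model (@sds_map R (sval d')) (@sds_base R (sval d')) (sval (sval B)))
    (N : model (@sds_map R (sval d)) (@sds_base R (sval d)) (sval (sval C))) :
    exists f : premorphism (sval (sval B)) (sval (sval C)), induces M N f (sval a).
  have [a_cont a_equiv a_base] := svalP a.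
  exact: (map_premorphism M N (cX d) (sX d) a_cont a_equiv a_base
    (sds_hom_surj a (svalP d'))).
pose pm (d d' : DS) (a : hom d d') := sval (cid (pm_exists d d' a _ _ (mdl d') (mdl d))).
have pmP (d d' : DS) (a : hom d d') : induces (mdl d') (mdl d) (pm _ _ a) (sval a).
  exact: (svalP (cid (pm_exists d d' a _ _ (mdl d') (mdl d)))).
pose Fm (d d' : DS) (a : hom d d') : hom (Fo d') (Fo d) := pclass (pm _ _ a).
have Fm_id (d : DS) : Fm d d (idm d) = idm (Fo d).
  apply/pclass_eq.
  exact: (@induces_pequiv _ _ _ _ (mdl d) (mdl d) _ _ id (pmP d d (idm d))
    (induces_pid (mdl d))).
have Fm_comp (d d' d'' : DS) (g : hom d' d'') (f : hom d d') :
    Fm _ _ (compm g f) = compm (Fm _ _ f) (Fm _ _ g).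
  rewrite /= obd_compE; apply/pclass_eq.
  exact: (@induces_pequiv _ _ _ _ (mdl d'') (mdl d) _ _ (sval g \o sval f)
    (pmP _ _ (compm g f)) (induces_pcomp (pmP _ _ g) (pmP _ _ f))).
exists (ContravariantFunctor Fm_id Fm_comp); split.
- move=> d d' h; have [a [a_cont a_equiv a_base ai]] :=
    premorphism_map (mdl d') (mdl d) (cX d') (sX d') (prepr h).
  pose a' : hom d d' := exist _ a (And3 a_cont a_equiv a_base).
  exists a'; rewrite -[h]preprK; apply/pclass_eq.
  exact: induces_pequiv (pmP _ _ a') ai.
- move=> d d' a b /pclass_eq ab; apply: sds_hom_eq.
  exact: pequiv_induces (pmP _ _ a) (pmP _ _ b) ab.
- move=> c; have [simplec infc] := svalP c.
  have [X [minX [M]]] := diagram_object R (svalP (sval c)) simplec infc.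
  pose d : DS := exist _ X minX; exists d.
  have [f fi] := pm_exists d d (idm d) (Fo d) c (mdl d) M.
  have [g gi] := pm_exists d d (idm d) c (Fo d) M (mdl d).
  exists (pclass f), (pclass g); split; rewrite /= obd_compE; apply/pclass_eq.
    exact: induces_pequiv (induces_pcomp fi gi) (induces_pid _).
  exact: induces_pequiv (induces_pcomp gi fi) (induces_pid _).
Qed.
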